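(* Let $D_1,\dots,D_N\subset\mathbb{R}^3$ be a system of $N\in\mathbb{N}$ resonators and let $C=(C_{ij})_{i,j=1}^N\in\mathbb{R}^{N\times N}$ be its capacitance matrix. Let $J_{N,1}\in\mathbb{R}^N$ denote the vector all of whose entries equal $1$, and define the landscape vector $\mathbf{u}\in\mathbb{R}^N$ as the solution to $$C\mathbf{u}=J_{N,1}.$$ Then for any eigenpair $(\lambda,\mathbf{v})\in(0,\infty)\times\mathbb{R}^N$ of $C$, that is, $\mathbf{v}\neq 0$ and $C\mathbf{v}=\lambda\mathbf{v}$, it holds that $$\frac{|\mathbf{v}_i|}{\|\mathbf{v}\|_\infty}\leq \lambda\,\mathbf{u}_i\qquad\text{for each } i=1,\dots,N,$$ where $\|\mathbf{v}\|_\infty:=\max_{j=1,\dots,N}|\mathbf{v}_j|$.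
   Context: Resonators: $D_1,\dots,D_N$ are nonempty bounded open subsets of $\mathbb{R}^3$ with pairwise disjoint closures, and each boundary $\partial D_n$ is of class $C^{1,s}$ for some $0<s<1$ (locally the graph of a differentiable function whose derivatives are Hölder continuous with exponent $s$). Write $D=\bigcup_{n=1}^N D_n$, so that $\partial D=\bigcup_{n=1}^N\partial D_n$. Laplace single layer potential: for $\varphi\in L^2(\partial D)$, $$\mathcal{S}_D^0[\varphi](x)=-\int_{\partial D}\frac{1}{4\pi|x-y|}\,\varphi(y)\,\mathrm{d}\sigma(y),$$ where $\sigma$ is surface measure. Restricted to $x\in\partial D$, it is invertible as a map from $L^2(\partial D)$ to $H^1(\partial D)$ (standard fact). Capacitance matrix: for $j=1,\dots,N$ let $\psi_j:=(\mathcal{S}_D^0)^{-1}[\chi_{\partial D_j}]\in L^2(\partial D)$, where $\chi_{\partial D_j}$ is the characteristic function of $\partial D_j$ (as a function on $\partial D$). The capacitance coefficients are the real numbers $$C_{ij}:=-\int_{\partial D_i}\psi_j\,\mathrm{d}\sigma,\qquad i,j=1,\dots,N,$$ and $C=(C_{ij})_{i,j=1}^N$ is the capacitance matrix. *)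

(* Defs.v *)
From HB Require Import structures.
From mathcomp Require Import all_boot all_order all_algebra.
From mathcomp Require Import all_classical all_reals all_analysis.

Set Implicit Arguments.
Unset Strict Implicit.
Unset Printing Implicit Defensive.

Import Order.TTheory GRing.Theory Num.Theory.
Import numFieldNormedType.Exports.

Local Open Scope classical_set_scope.
Local Open Scope ring_scope.

(* The library norm on ['rV[R]_n] is the sup norm. *)
Definition enorm (R : realType) (n : nat) (x : 'rV[R]_n) : R :=
  Num.sqrt (\sum_(i < n) x ord0 i ^+ 2).

Section hausdorff.
Context {R : realType}.
Local Open Scope ereal_scope.
Implicit Types (A U : set 'rV[R]_3) (F : (set 'rV[R]_3)^nat).

(* [maxe 0] because the supremum over the empty set is [-oo]. *)
Definition ediam U : \bar R :=
  maxe 0 (ereal_sup [set (enorm (x - y))%:E | x in U & y in U]).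

Definition fine_cover (delta : R) A : set ((set 'rV[R]_3)^nat) :=
  [set F | (forall k, ediam (F k) <= delta%:E) /\ A `<=` \bigcup_k F k].

(* [pi / 4] normalises the measure so that it is the area on planes. *)
Definition hausdorff2_size U : \bar R := (pi / 4)%:E * ediam U ^+ 2.

Definition hausdorff2_pre (delta : R) A : \bar R :=
  ereal_inf [set \sum_(k <oo) hausdorff2_size (F k) | F in fine_cover delta A].

Definition hausdorff2 A : \bar R :=
  ereal_sup [set hausdorff2_pre delta A | delta in [set d : R | (0 < d)%R]].

Lemma ediam_ge0 U : 0 <= ediam U.
Proof. by rewrite /ediam le_max lexx. Qed.

Lemma ediam0 : ediam set0 = 0.
Proof.
rewrite /ediam [X in ereal_sup X](_ : _ = set0) ?ereal_sup0 ?maxeNy//.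
by apply/seteqP; split=> z /= [].
Qed.

Lemma hausdorff2_size_ge0 U : 0 <= hausdorff2_size U.
Proof.
apply: mule_ge0; first by rewrite lee_fin divr_ge0 ?pi_ge0.
by rewrite expe_ge0 ?ediam_ge0.
Qed.

Lemma hausdorff2_size0 : hausdorff2_size set0 = 0.
Proof. by rewrite /hausdorff2_size ediam0 expe2 mule0 mule0. Qed.

Lemma le_hausdorff2_pre delta :
  {homo hausdorff2_pre delta : A B / A `<=` B >-> A <= B}.
Proof.
move=> A B AB; apply/ereal_inf_le_tmp => x [F [dF BF]] <-{x}.
by exists F => //; split => //; exact: subset_trans AB BF.
Qed.

Lemma hausdorff2_pre_ge0 delta A : 0 <= hausdorff2_pre delta A.
Proof.
apply: le_ereal_inf_tmp => x [F _ <-{x}].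
by apply: nneseries_ge0 => *; exact: hausdorff2_size_ge0.
Qed.

Lemma hausdorff2_pre0 delta : (0 < delta)%R -> hausdorff2_pre delta set0 = 0.
Proof.
move=> d0; apply/eqP; rewrite eq_le hausdorff2_pre_ge0 andbT.
apply: ereal_inf_lbound; exists (fun=> set0).
  by split => // k; rewrite ediam0 lee_fin ltW.
by apply: eseries0 => *; exact: hausdorff2_size0.
Qed.

Lemma hausdorff2_pre_sigma_subadditive delta :
  sigma_subadditive (hausdorff2_pre delta).
Proof.
set mu := hausdorff2_size; set mus := hausdorff2_pre delta.
have mu_ge0 : forall U, 0 <= mu U by exact: hausdorff2_size_ge0.
have mus_ge0 : forall U, 0 <= mus U by exact: hausdorff2_pre_ge0.
move=> A; have [[i ioo]|] := pselect (exists i, mus (A i) = +oo).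
  rewrite (eseries_pinfty _ _ ioo) ?leey// => n _.
  by rewrite -ltNye (lt_le_trans _ (mus_ge0 _)).
rewrite -forallNE => Aoo.
suff add2e (e : {posnum R}) :
    mus (\bigcup_n A n) <= \sum_(i <oo) mus (A i) + e%:num%:E.
  by apply/lee_addgt0Pr => _/posnumP[].
rewrite (le_trans _ (epsilon_trick _ _ _))//.
pose P n (B : (set 'rV[R]_3)^nat) := fine_cover delta (A n) B /\
  \sum_(k <oo) mu (B k) <= mus (A n) + (e%:num / (2 ^ n.+1)%:R)%:E.
have [G PG] : {G : ((set 'rV[R]_3)^nat)^nat & forall n, P n (G n)}.
  apply: (@choice _ _ P) => n; rewrite /P /mus /hausdorff2_pre.
  set S := (X in ereal_inf X); move infS : (ereal_inf S) => iS.
  case: iS infS => [r Sr|Soo|Soo].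
  - have en1 : (0 < e%:num / (2 ^ n.+1)%:R)%R by [].
    have /(lb_ereal_inf_adherent en1) : ereal_inf S \is a fin_num by rewrite Sr.
    move=> [x [B [mB AnB] muBx] xS].
    by exists B; split => //; rewrite /mu muBx -Sr; exact/ltW.
  - by have := Aoo n; rewrite /mus /hausdorff2_pre Soo.
  - suff : lbound S 0 by move/le_ereal_inf_tmp; rewrite Soo.
    by move=> /= _ [B [mB AnB] <-]; exact: nneseries_ge0.
have muG_ge0 x : 0 <= (mu \o uncurry G) x by exact: mu_ge0.
apply: (@le_trans _ _ (\esum_(i in setT) (mu \o uncurry G) i)).
  apply: ereal_inf_lbound => /=.
  have /card_esym/ppcard_eqP[f] := card_nat2.
  exists (uncurry G \o f).
    split => [i|].
      by rewrite /= /uncurry; case: (f i) => a b; exact: (PG a).1.1.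
    apply: (@subset_trans _  (\bigcup_n \bigcup_k G n k)) => [t [i _]|].
      by move=> /((PG i).1.2) -[j _ ?]; exists i => //; exists j.
    move=> t [i _ [j _ Bijt]]; exists (f^-1%FUN (i, j)) => //=.
    by rewrite invK ?inE.
  rewrite -(esum_pred_image (mu \o uncurry G) _ xpredT) ?[fun=> _]set_true//.
  by rewrite image_eq.
rewrite (_ : esum _ _ = \sum_(i <oo) \sum_(j <oo ) mu (G i j)); last first.
  pose J : nat -> set (nat * nat) := fun i => [set (i, j) | j in setT].
  rewrite (_ : setT = \bigcup_k J k); last first.
    by rewrite predeqE => -[a b]; split => // _; exists a => //; exists b.
  rewrite esum_bigcupT /=; last 2 first.
    - apply/trivIsetP => i j _ _ ij.
      rewrite predeqE => -[n m] /=; split => //= -[] [_] _ [<-{n} _].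
      by move=> [m' _] [] /esym/eqP; rewrite (negbTE ij).
    - by move=> /= [n m]; exact: mu_ge0.
  rewrite -(image_id [set: nat]) -fun_true esum_pred_image//; last first.
    by move=> n _; exact: esum_ge0.
  apply: eq_eseriesr => /= j _.
  rewrite -(esum_pred_image (mu \o uncurry G) (pair j) predT)//=; last first.
    by move=> ? ? _ _; exact: (@can_inj _ _ _ snd).
  by congr esum; rewrite predeqE => -[a b]; split; move=> [i _ <-]; exists i.
apply: lee_lim.
- apply: is_cvg_nneseries => n *.
  by apply: nneseries_ge0 => m *; exact: (muG_ge0 (n, m)).
- by apply: is_cvg_nneseries => n *; apply: adde_ge0.
- by near=> n; apply: lee_sum => i _; exact: (PG i).2.
Unshelve. all: by end_near. Qed.

Lemma hausdorff20 : hausdorff2 set0 = 0.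
Proof.
apply/eqP; rewrite eq_le; apply/andP; split.
  by apply: ge_ereal_sup => _ [d d0 <-]; rewrite hausdorff2_pre0.
by apply: ereal_sup_ubound; exists 1%R; rewrite /= ?ltr01// hausdorff2_pre0.
Qed.

Lemma hausdorff2_ge0 A : 0 <= hausdorff2 A.
Proof.
apply: (le_trans (hausdorff2_pre_ge0 1 A)).
by apply: ereal_sup_ubound; exists 1%R => //=; exact: ltr01.
Qed.

Lemma le_hausdorff2 : {homo hausdorff2 : A B / A `<=` B >-> A <= B}.
Proof.
move=> A B AB; apply: ge_ereal_sup => _ [d d0 <-].
apply: (le_trans (le_hausdorff2_pre d AB)).
by apply: ereal_sup_ubound; exists d.
Qed.

Lemma hausdorff2_sigma_subadditive : sigma_subadditive hausdorff2.
Proof.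
move=> F; apply: ge_ereal_sup => _ [d d0 <-].
apply: (le_trans (hausdorff2_pre_sigma_subadditive d F)).
apply: lee_nneseries => [k _ _|k _]; first exact: hausdorff2_pre_ge0.
by apply: ereal_sup_ubound; exists d.
Qed.

HB.instance Definition _ := isOuterMeasure.Build R 'rV[R]_3 hausdorff2
  hausdorff20 hausdorff2_ge0 le_hausdorff2 hausdorff2_sigma_subadditive.

End hausdorff.

Definition hausdorff2_outer (R : realType) :
  {outer_measure set 'rV[R]_3 -> \bar R} := @hausdorff2 R.

(* [R^3] with the Caratheodory sigma-algebra of the outer measure. *)
Definition R3 (R : realType) : Type := caratheodory_type (hausdorff2_outer R).

(* Surface measure on a surface [S] is the restriction to [S] of the
   two-dimensional Hausdorff measure of [R^3]. *)
Definition sigma (R : realType) : {measure set (R3 R) -> \bar R} :=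
  (hausdorff2_outer R : set (caratheodory_type (hausdorff2_outer R)) -> \bar R).

Section resonators.
Context {R : realType}.
Local Notation R3 := (R3 R).
Local Notation sigma := (sigma R).

Definition boundary (A : set 'rV[R]_3) : set R3 := closure A `\` A^°.

(* Near each of its points, and in a suitable orthonormal frame [Q] centred at
   that point, [S] is the graph of [g], a function of the first two
   coordinates with [s]-Hoelder derivatives.
   [col' ord_max] deletes the last coordinate. *)
Definition C1_holder_surface (s : R) (S : set 'rV[R]_3) : Prop :=
  forall p, S p -> exists (Q : 'M[R]_3) (r : R) (g : 'rV[R]_2 -> R),
  [/\ Q *m Q^T = 1%:M, 0 < r,
      (forall z, enorm z < r -> differentiable g z),
      (exists K : R, forall z w (i : 'I_2), enorm z < r -> enorm w < r ->
         `|'D_(delta_mx ord0 i) g z - 'D_(delta_mx ord0 i) g w|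
           <= K * enorm (z - w) `^ s) &
      (forall x, enorm (x - p) < r ->
         (S x <-> let y := (x - p) *m Q in
                  y ord0 ord_max = g (col' ord_max y)))].

Definition resonators (N : nat) (s : R) (D : 'I_N -> set 'rV[R]_3) : Prop :=
  [/\ (forall n, [/\ D n !=set0, bounded_set (D n) & open (D n)]),
      (forall m n, m != n -> closure (D m) `&` closure (D n) = set0) &
      (forall n, C1_holder_surface s (boundary (D n)))].

Definition square_integrable (S : set R3) (phi : R3 -> R) : Prop :=
  measurable_fun S phi /\ (\int[sigma]_(y in S) (phi y ^+ 2)%:E < +oo)%E.

Definition single_layer (S : set R3) (phi : R3 -> R) (x : 'rV[R]_3) : R :=
  - \int[sigma]_(y in S) ((4 * pi * enorm (x - y))^-1 * phi y).

(* [psi j] is a representative of the preimage of the indicator of the [j]-th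
   boundary; elements of [H^1] of the boundary agree when they are equal almost
   everywhere. *)
Definition capacitance_matrix (N : nat) (D : 'I_N -> set 'rV[R]_3)
    (C : 'M[R]_N) : Prop :=
  let bD := boundary (\bigcup_n D n) in
  exists psi : 'I_N -> R3 -> R,
  [/\ (forall j, square_integrable bD (psi j)),
      (forall j, {ae sigma, forall x, bD x ->
         single_layer bD (psi j) x = \1_(boundary (D j)) x}) &
      (forall i j, C i j = - \int[sigma]_(y in boundary (D i)) psi j y)].

Definition vnorm_max (N : nat) (v : 'cV[R]_N) : R :=
  \big[Num.max/0]_(j < N) `|v j ord0|.

End resonators.

(* Main.v *)
(* Only one property of the capacitance matrix is needed: if all entries of [C a] are
   positive then all entries of [a] are nonnegative.  It is applied to
   [(lambda |v| + d) u - t v] with [t = 1] or [-1] and [d > 0] small, and to [u].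
   Let [f = - sum_j a_j psi_j].  Its Newtonian potential is a constant multiple of [a_i]
   on the i-th boundary and its charge there is [(C a)_i], so it suffices that a
   Newtonian potential carries a charge [<= 0] on its sublevel sets at negative levels.
   This is discretised: on the lattice [Z^3], let [G] be the Green function of the walk
   whose coordinates are independent and make steps -1, 0, 1 with probabilities 1/4, 1/2,
   1/4.  For a potential [U = G * mu] the measure [mu] equals [U - P U], where [P U] is an
   average of translates of [U]; a finite sublevel set [S] of [U] minimises the sum of [U]
   among its translates, so [mu S <= 0].  Since [|z| G z] tends to a positive constant (a
   local limit theorem for explicit binomial probabilities), the lattice potentials of
   mesh [1/m] converge almost everywhere to the Newtonian potential.  The convergence
   needs that the potential of [|f|] is finite almost everywhere, which follows from the
   bound [C r^2] for the area of the surface inside balls of radius [r]. *)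

Require Import Defs.
From HB Require Import structures.
From mathcomp Require Import all_boot all_order all_algebra.
From mathcomp Require Import finmap.
From mathcomp Require Import all_classical all_reals all_analysis.
From mathcomp Require Import measurable_realfun.
From mathcomp Require Import ring lra zify.

Set Implicit Arguments.
Unset Strict Implicit.
Unset Printing Implicit Defensive.

Import Order.TTheory GRing.Theory Num.Theory.
Import numFieldNormedType.Exports.

Local Open Scope classical_set_scope.
Local Open Scope ring_scope.

(** * The lattice Green function *)

Section walk.
Context {R : realType}.

(* [walk n j = 'C(2n, n + j) / 4 ^ n]. *)
Fixpoint walk (n : nat) (j : int) : R :=
  if n is n'.+1 then (walk n' (j - 1) + 2 * walk n' j + walk n' (j + 1)) / 4
  else (j == 0)%:R.

Lemma walkS n j :
  walk n.+1 j = (walk n (j - 1) + 2 * walk n j + walk n (j + 1)) / 4.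
Proof. by []. Qed.

Lemma walk_ge0 n j : 0 <= walk n j.
Proof.
elim: n j => [|n IH] j /=; first by rewrite ler0n.
by rewrite divr_ge0// !addr_ge0// mulr_ge0.
Qed.

Lemma walkN n j : walk n (- j) = walk n j.
Proof.
elim: n j => [|n IH] j /=; first by rewrite oppr_eq0.
have -> : - j + 1 = - (j - 1) by rewrite opprB addrC.
rewrite -opprD !IH; congr (_ / _); ring.
Qed.

(** The quotient of neighbouring binomial coefficients, multiplied out so that it also holds where
    [n + 1 + j] vanishes. The induction step combines the instances at [j - 1], [j] and [j + 1]. *)
Lemma walk_ratio n (j : int) :
  (n%:R + 1 + j%:~R) * walk n (j + 1) = (n%:R - j%:~R) * walk n j.
Proof.
elim: n j => [|n IH] j.
  rewrite /=.
  have [->|j0] := eqVneq j 0; first by rewrite /= mulr0 subrr mul0r.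
  have [/eqP|j1] := eqVneq (j + 1) 0; last by rewrite !mulr0.
  by rewrite addr_eq0 => /eqP ->; rewrite mulr0n add0r mulrN1z subrr mul0r mulr0.
have IH1 := IH (j - 1); have IH2 := IH j; have IH3 := IH (j + 1).
rewrite /=.
rewrite subrK in IH1; rewrite addrK.
rewrite !intrD !intrN in IH1 IH2 IH3 *.
rewrite -natr1.
nra.
Qed.

Lemma walk_succ n (j : nat) :
  walk n j.+1%:Z = (n%:R - j%:R) / (n%:R + 1 + j%:R) * walk n j%:Z.
Proof.
have := walk_ratio n j%:Z; rewrite -PoszD addn1 => e.
have p : n%:R + 1 + j%:R != 0 :> R by rewrite gt_eqF// ltr_wpDr // ltr_wpDl.
by rewrite mulrAC -[X in X / _]e mulrAC mulfV// mul1r.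
Qed.

(** The factor [n - j] in [walk_succ] is [<= 0]. With [walk_ge0] this says that [n] steps do not
    lead beyond distance [n]. *)
Lemma walk_succ_le0 (n j : nat) : (n <= j)%N -> walk n j.+1%:Z <= 0.
Proof.
move=> nj; rewrite walk_succ; apply: mulr_le0_ge0; last exact: walk_ge0.
apply: mulr_le0_ge0; first by rewrite subr_le0 ler_nat.
by rewrite invr_ge0 !addr_ge0.
Qed.

Definition wreturn n : R := walk n 0.

Lemma wreturn0 : wreturn 0 = 1. Proof. by []. Qed.

Lemma wreturnS n : wreturn n.+1 = (2 * n%:R + 1) / (2 * n%:R + 2) * wreturn n.
Proof.
rewrite /wreturn walkS !add0r walkN (walk_succ n 0) subr0 addr0.
have h : n%:R + 1 != 0 :> R by rewrite gt_eqF// ltr_wpDl.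
by field; rewrite h /= gt_eqF// ltr_wpDl// mulr_ge0.
Qed.

Lemma wreturn_gt0 n : 0 < wreturn n.
Proof.
elim: n => [|n IH]; first by rewrite wreturn0.
by rewrite wreturnS mulr_gt0// divr_gt0// ltr_wpDl// mulr_ge0.
Qed.

(** The left side is 1 at [n = 0] and nonincreasing, because [(2n+1)(2n+3) <= (2n+2)^2]. The product
    in [wreturn_sqr_ge] is nondecreasing instead; together they fix the decay [n^(-1/2)]. *)
Lemma wreturn_sqr_le n : wreturn n ^+ 2 * (2 * n%:R + 1) <= 1.
Proof.
elim: n => [|n IH]; first by rewrite wreturn0 mulr0 add0r expr1n mulr1.
apply: le_trans IH; rewrite wreturnS -natr1.
have n0 : 0 <= n%:R :> R by [].
rewrite exprMn mulrAC [leRHS]mulrC ler_wpM2r ?sqr_ge0//.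
rewrite exprMn exprVn mulrAC ler_pdivrMr; last by rewrite exprn_gt0// ltr_wpDl// mulr_ge0.
nra.
Qed.

Lemma wreturn_sqr_ge n : 1 <= wreturn n ^+ 2 * (4 * n%:R + 1).
Proof.
elim: n => [|n IH]; first by rewrite wreturn0 mulr0 add0r expr1n mulr1.
apply: (le_trans IH); rewrite wreturnS -natr1.
have n0 : 0 <= n%:R :> R by [].
rewrite exprMn [leRHS]mulrAC [leLHS]mulrC ler_wpM2r ?sqr_ge0//.
rewrite exprMn exprVn mulrAC ler_pdivlMr; last by rewrite exprn_gt0// ltr_wpDl// mulr_ge0.
nra.
Qed.

Lemma wreturn_sqr_nd :
  {homo (fun n => n%:R * wreturn n ^+ 2) : m n / (m <= n)%N >-> m <= n}.
Proof.
apply/nondecreasing_seqP => n; rewrite wreturnS -natr1.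
have n0 : 0 <= n%:R :> R by [].
rewrite exprMn [leRHS]mulrA ler_wpM2r ?sqr_ge0//.
rewrite exprMn exprVn mulrA ler_pdivlMr; last by rewrite exprn_gt0// ltr_wpDl// mulr_ge0.
nra.
Qed.

(* Makes the series of the [wreturn n ^+ 3] telescope. *)
Lemma wreturn_cube_le n : wreturn n ^+ 3 <= 2 * (wreturn n - wreturn n.+1).
Proof.
have := wreturn_sqr_le n; have := wreturn_gt0 n; rewrite wreturnS.
set b := wreturn n => b0 hb; have n0 : 0 <= n%:R :> R by [].
have -> : 2 * (b - (2 * n%:R + 1) / (2 * n%:R + 2) * b) = b / (n%:R + 1).
  by field; rewrite !gt_eqF// ltr_wpDl// mulr_ge0.
rewrite exprS ler_pM2l//.
rewrite -[leRHS]mul1r ler_pdivlMr ?ltr_wpDl//.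
by apply: le_trans hb; rewrite ler_wpM2l ?sqr_ge0//; lra.
Qed.

(** The local limit theorem at the origin: the sequence is bounded and nondecreasing, and its value
    at [n = 1] is already positive. *)
Lemma wreturn_cvg :
  exists2 c2 : R, 0 < c2 & (fun n : nat => n%:R * wreturn n ^+ 2) @ \oo --> c2.
Proof.
set a := (fun n : nat => _ : R).
have cv : cvgn a.
  apply: (nondecreasing_is_cvgn wreturn_sqr_nd).
  exists 1 => _ [n _ <-]; apply: le_trans (wreturn_sqr_le n).
  by rewrite /a mulrC ler_wpM2l ?sqr_ge0//; have : 0 <= n%:R :> R by []; lra.
exists (limn a) => //.
have : a 1%N <= limn a by apply: nondecreasing_cvgn_le => //; exact: wreturn_sqr_nd.
apply: lt_le_trans; rewrite /a mul1r exprn_gt0//; exact: wreturn_gt0.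
Qed.

(** Consecutive values have quotient [1 - (2j+1)/(n+1+j)], which is at most [exp(-(2j+1)/(n+J))] for
    [j < J], and the odd numbers [2j+1] add up to a square. The parameter [J] keeps the denominator
    fixed in the induction, and later common to three coordinates. *)
Lemma walk_le (n J j : nat) : (j <= J)%N ->
  walk n j%:Z <= wreturn n * expR (- (j%:R ^+ 2 / (n + J)%:R)).
Proof.
elim: j => [|j IH] jJ; first by rewrite expr0n /= mul0r oppr0 expR0 mulr1.
have [nj|jn] := leqP n j.
  have : walk n j.+1%:Z <= 0.
    by rewrite walk_succ_le0.
  move=> h; apply: (le_trans h); rewrite mulr_ge0 ?expR_ge0//.
  exact/ltW/wreturn_gt0.
have {}IH := IH (ltnW jJ).
have nJ : 0 < (n + J)%:R :> R by rewrite ltr0n; lia.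
rewrite walk_succ.
have -> : - (j.+1%:R ^+ 2 / (n + J)%:R) =
  - (j%:R ^+ 2 / (n + J)%:R) - (2 * j%:R + 1) / (n + J)%:R :> R.
  by rewrite -opprD -mulrDl -natr1; congr (- (_ / _)); ring.
rewrite expRD mulrA mulrC; apply: ler_pM => //.
- exact: walk_ge0.
- by rewrite divr_ge0 ?subr_ge0 ?ler_nat ?(ltnW jn)// addr_ge0.
apply: le_trans (expR_ge1Dx _).
have p : 0 < n%:R + 1 + j%:R :> R by rewrite ltr_wpDr // ltr_wpDl.
have -> : (n%:R - j%:R) / (n%:R + 1 + j%:R) =
    1 - (2 * j%:R + 1) / (n%:R + 1 + j%:R) :> R by field; rewrite gt_eqF.
rewrite lerD2l lerN2 ler_wpM2l ?addr_ge0 ?mulr_ge0//.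
rewrite lef_pV2 ?posrE// natrD -addrA lerD2l nat1r ler_nat//.
Qed.

(** Here the inverse quotient [1 + (2j+1)/(n-j)] is bounded by [exp((2j+1)/(n-J+1))] for [j < J]. *)
Lemma walk_ge (n J j : nat) : (j <= J)%N -> (J <= n)%N ->
  wreturn n * expR (- (j%:R ^+ 2 / (n - J).+1%:R)) <= walk n j%:Z.
Proof.
move=> + Jn; elim: j => [|j IH] jJ; first by rewrite expr0n /= mul0r oppr0 expR0 mulr1.
have {}IH := IH (ltnW jJ).
have nJ : 0 < (n - J).+1%:R :> R by rewrite ltr0n.
rewrite walk_succ.
have -> : - (j.+1%:R ^+ 2 / (n - J).+1%:R) =
  - (j%:R ^+ 2 / (n - J).+1%:R) - (2 * j%:R + 1) / (n - J).+1%:R :> R.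
  by rewrite -opprD -mulrDl -[j.+1%:R]natr1; congr (- (_ / _)); ring.
rewrite expRD mulrA [leRHS]mulrC; apply: ler_pM => //.
  by rewrite mulr_ge0 ?expR_ge0//; exact/ltW/wreturn_gt0.
have d : 0 < n%:R - j%:R :> R by rewrite subr_gt0 ltr_nat (leq_trans jJ).
have p : 0 < n%:R + 1 + j%:R :> R by rewrite ltr_wpDr // ltr_wpDl.
rewrite expRN -[leRHS]invf_div lef_pV2 ?posrE ?expR_gt0 ?divr_gt0//.
apply: le_trans (expR_ge1Dx _).
have -> : (n%:R + 1 + j%:R) / (n%:R - j%:R) =
    1 + (2 * j%:R + 1) / (n%:R - j%:R) :> R by field; rewrite gt_eqF.
rewrite lerD2l ler_wpM2l ?addr_ge0 ?mulr_ge0//.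
rewrite lef_pV2 ?posrE// -natrB ?ler_nat; lia.
Qed.

Lemma walk_le_diff (n j : nat) : (0 < n)%N ->
  walk n j%:Z <= wreturn n * expR (- (j%:R ^+ 2 / (2 * n%:R))).
Proof.
move=> n0; have [nj|jn] := leqP j n.
  by have := walk_le n nj; rewrite addnn -muln2 mulnC natrM.
have : walk n j%:Z <= 0.
  case: j jn => // j; rewrite ltnS => nj.
  by rewrite walk_succ_le0.
by move=> /le_trans; apply; rewrite mulr_ge0 ?expR_ge0//; exact/ltW/wreturn_gt0.
Qed.

Lemma walk_abs n (j : int) : walk n j = walk n `|j|%:Z.
Proof. by case: j => k //; rewrite NegzE walkN. Qed.

End walk.

(** * The walk on [Z^3] and its Green function *)

Definition lattice : Type := (int * int * int)%type.
HB.instance Definition _ := GRing.Zmodule.on lattice.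

Section green.
Context {R : realType}.
Local Notation walk := (@walk R).
Local Notation wreturn := (@wreturn R).
Implicit Types z : lattice.

Definition nsq z : R := z.1.1%:~R ^+ 2 + z.1.2%:~R ^+ 2 + z.2%:~R ^+ 2.

Definition lnorm z : R := Num.sqrt (nsq z).

Lemma nsq_ge0 z : 0 <= nsq z.
Proof. by rewrite !addr_ge0 ?sqr_ge0. Qed.

Lemma lnorm_sqr z : lnorm z ^+ 2 = nsq z.
Proof. by rewrite sqr_sqrtr ?nsq_ge0. Qed.

Lemma absz_sqr (j : int) : `|j|%N%:R ^+ 2 = j%:~R ^+ 2 :> R.
Proof. by rewrite natr_absz intr_norm real_normK// num_real. Qed.

Definition heat n z : R := walk n z.1.1 * walk n z.1.2 * walk n z.2.

Lemma heat_ge0 n z : 0 <= heat n z.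
Proof. by rewrite !mulr_ge0 ?walk_ge0. Qed.

Let expR3 (a b c d : R) :
  expR (- (a / d)) * expR (- (b / d)) * expR (- (c / d)) =
  expR (- ((a + b + c) / d)).
Proof. by rewrite -!expRD -!opprD -!mulrDl. Qed.

Let mul3 (w a b c : R) : w ^+ 3 * (a * b * c) = w * a * (w * b) * (w * c).
Proof. by ring. Qed.

Lemma heat_le n z : (0 < n)%N ->
  heat n z <= wreturn n ^+ 3 * expR (- (nsq z / (2 * n%:R))).
Proof.
move=> n0; rewrite -expR3 mul3 -!absz_sqr /heat.
rewrite (walk_abs _ z.1.1) (walk_abs _ z.1.2) (walk_abs _ z.2).
by apply: ler_pM; rewrite ?mulr_ge0 ?walk_ge0 ?walk_le_diff// ler_pM ?walk_ge0 ?walk_le_diff.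
Qed.

Definition lsup z : nat := maxn `|z.1.1| (maxn `|z.1.2| `|z.2|).

(** When [lsup z] is small compared with [n], the denominator is close to [n]; so this bound, unlike
    [heat_le], is sharp in the limit. [heat_ge_sup] matches it from below. *)
Lemma heat_le_sup n z :
  heat n z <= wreturn n ^+ 3 * expR (- (nsq z / (n + lsup z)%:R)).
Proof.
rewrite -expR3 mul3 -!absz_sqr /heat.
rewrite (walk_abs _ z.1.1) (walk_abs _ z.1.2) (walk_abs _ z.2).
have h j : (`|j| <= lsup z)%N -> _ := fun h => @walk_le R n _ `|j| h.
have h1 := h z.1.1 (leq_maxl _ _).
have h2 : (`|z.1.2| <= lsup z)%N by rewrite /lsup; lia.
have h3 : (`|z.2| <= lsup z)%N by rewrite /lsup; lia.
apply: ler_pM; rewrite ?mulr_ge0 ?walk_ge0//; last exact: h.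
by apply: ler_pM; rewrite ?walk_ge0//; exact: h.
Qed.

Lemma heat_ge_sup n z : (lsup z <= n)%N ->
  wreturn n ^+ 3 * expR (- (nsq z / (n - lsup z).+1%:R)) <= heat n z.
Proof.
move=> zn; rewrite -expR3 mul3 -!absz_sqr /heat.
rewrite (walk_abs _ z.1.1) (walk_abs _ z.1.2) (walk_abs _ z.2).
have h j : (`|j| <= lsup z)%N -> _ := fun h => @walk_ge R n _ `|j| h zn.
have p j d : 0 <= wreturn n * expR (- (`|j|%N%:R ^+ 2 / d)) :> R.
  by rewrite mulr_ge0 ?expR_ge0// ltW// wreturn_gt0.
have h1 := h z.1.1 (leq_maxl _ _).
have h2 : (`|z.1.2| <= lsup z)%N by rewrite /lsup; lia.
have h3 : (`|z.2| <= lsup z)%N by rewrite /lsup; lia.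
apply: ler_pM => //; [by rewrite mulr_ge0| |exact: h].
by apply: ler_pM => //; exact: h.
Qed.

Lemma lsup_le z : (lsup z)%:R <= lnorm z.
Proof.
rewrite -(@ler_pXn2r _ 2) ?nnegrE ?sqrtr_ge0// lnorm_sqr.
rewrite /lsup; case: (leqP `|z.1.2| `|z.2|) => _; case: leqP => _;
  rewrite absz_sqr /nsq;
  have := sqr_ge0 (z.1.1%:~R : R); have := sqr_ge0 (z.1.2%:~R : R);
  have := sqr_ge0 (z.2%:~R : R); lra.
Qed.

Lemma heat_le_cube n z : heat n z <= wreturn n ^+ 3.
Proof.
apply: (le_trans (heat_le_sup n z)); rewrite ler_piMr ?exprn_ge0//.
  exact/ltW/wreturn_gt0.
by rewrite expR_le1 oppr_le0 divr_ge0 ?nsq_ge0.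
Qed.

Lemma sum_cube_le m : \sum_(0 <= n < m) wreturn n ^+ 3 <= 2.
Proof.
apply: (@le_trans _ _ (\sum_(0 <= n < m) 2 * (wreturn n - wreturn n.+1))).
  by apply: ler_sum => n _; exact: wreturn_cube_le.
rewrite -mulr_sumr; under eq_bigr do rewrite -opprB; rewrite sumrN telescope_sumr//.
by rewrite opprB wreturn0 ler_piMr// lerBlDr lerDl ltW// wreturn_gt0.
Qed.

(** Transience in dimension three: the terms are dominated by [wreturn n ^+ 3], of order
    [n^(-3/2)]. *)
Lemma cvg_series_heat z : cvgn (series (heat^~ z)).
Proof.
apply: nondecreasing_is_cvgn.
  apply/nondecreasing_seqP => n.
  by rewrite seriesEnat /= big_nat_recr//= lerDl heat_ge0.
exists 2 => _ [m _ <-]; apply: le_trans (sum_cube_le m).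
by rewrite seriesEnat /=; apply: ler_sum => n _; exact: heat_le_cube.
Qed.

Definition green z : R := limn (series (heat^~ z)).

Lemma series_heat_le_green z m : series (heat^~ z) m <= green z.
Proof.
apply: nondecreasing_cvgn_le; last exact: cvg_series_heat.
apply/nondecreasing_seqP => n.
by rewrite seriesEnat /= big_nat_recr//= lerDl heat_ge0.
Qed.

Lemma green_ge0 z : 0 <= green z.
Proof. by apply: le_trans (series_heat_le_green z 0); rewrite seriesEnat /= big_geq. Qed.

Lemma green_le2 z : green z <= 2.
Proof.
apply: limr_le; first exact: cvg_series_heat.
near=> m; rewrite seriesEnat /=; apply: le_trans (sum_cube_le m).
by apply: ler_sum => n _; exact: heat_le_cube.
Unshelve. all: by end_near. Qed.

(** In each coordinate the indices 0, 1, 2 stand for the steps -1, 0, 1, so the triples encode the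
    27 joint steps. *)
Definition weight (e : 'I_3 * 'I_3 * 'I_3) : R :=
  let w (i : 'I_3) : R := [:: 1/4; 1/2; 1/4]`_i in w e.1.1 * w e.1.2 * w e.2.

Definition lstep (e : 'I_3 * 'I_3 * 'I_3) : lattice :=
  (e.1.1%:Z - 1, e.1.2%:Z - 1, e.2%:Z - 1).

Definition laverage (g : lattice -> R) z : R := \sum_e weight e * g (z + lstep e).

Lemma weight_ge0 e : 0 <= weight e.
Proof.
have w (i : 'I_3) : 0 <= [:: 1/4; 1/2; 1/4]`_i :> R.
  by case: i => [[|[|[|//]]]] _ /=; rewrite divr_ge0.
by rewrite /weight !mulr_ge0.
Qed.

Lemma sum_weight : \sum_e weight e = 1.
Proof.
rewrite -(pair_bigA _ (fun i j => weight (i, j))) /=.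
rewrite -(pair_bigA _ (fun i j => \sum_k weight (i, j, k))) /=.
rewrite /weight !(big_ord_recl, big_ord0) /=; lra.
Qed.

Lemma heatS n z : heat n.+1 z = laverage (heat n) z.
Proof.
have w j : walk n.+1 j =
    \sum_(i < 3) [:: 1/4; 1/2; 1/4]`_i * walk n (j + (i%:Z - 1)).
  rewrite !(big_ord_recl, big_ord0) walkS /= sub0r.
  have -> : j + (1%Z - 1) = j by rewrite subrr addr0.
  by rewrite (_ : 2%Z - 1 = 1)//; lra.
rewrite /laverage -(pair_bigA _ (fun i j => weight (i, j) * heat n (z + lstep (i, j)))) /=.
rewrite -(pair_bigA _ (fun i j => \sum_k weight (i, j, k) * heat n (z + lstep (i, j, k)))) /=.
rewrite {1}/heat !w big_distrlr /= big_distrl /=; apply: eq_bigr => i _.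
rewrite big_distrl /=; apply: eq_bigr => j _.
rewrite big_distrr /=; apply: eq_bigr => k _.
rewrite /weight /heat /=; ring.
Qed.

(** [green] is the fundamental solution of [I - P]. By [heatS], the partial sums shifted by one are
    the unit mass at 0 plus the average of the partial sums; then pass to the limit. *)
Lemma green_laverage z : green z - laverage green z = (z == 0)%:R.
Proof.
have cv y := cvg_series_heat y.
have h0 : heat 0 z = (z == 0)%:R.
  rewrite /heat /=; case: z => [[a b] c] /=.
  by rewrite !xpair_eqE -!natrM !mulnb.
have : series (heat^~ z) m.+1 @[m --> \oo] --> (z == 0)%:R + laverage green z.
  have -> : (fun m => series (heat^~ z) m.+1) =
      (fun m => (z == 0)%:R + laverage (fun y => series (heat^~ y) m) z).
    apply/funext => m; rewrite seriesEnat /= big_nat_recl//= h0; congr (_ + _).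
    rewrite /laverage.
    under [RHS]eq_bigr do rewrite seriesEnat /= big_distrr /=.
    by rewrite exchange_big /=; apply: eq_bigr => k _; exact: heatS.
  apply: cvgD; first exact: cvg_cst.
  rewrite /laverage; apply: cvg_big => [|e _]; first exact: add_continuous.
  by apply: cvgM; [exact: cvg_cst|exact: cv].
move/(cvg_lim (@Rhausdorff _)) => l.
have : series (heat^~ z) m.+1 @[m --> \oo] --> green z.
  by rewrite cvg_shiftS; exact: cv.
by move/(cvg_lim (@Rhausdorff _)); rewrite l => <-; rewrite addrK.
Qed.

End green.

(** * Boundedness and convergence of [lnorm z * green z] *)

Section green_asymptotics.
Context {R : realType}.
Local Notation walk := (@walk R).
Local Notation wreturn := (@wreturn R).
Local Notation nsq := (@nsq R).
Local Notation lnorm := (@lnorm R).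
Local Notation heat := (@heat R).
Local Notation green := (@green R).
Local Notation mu := (@lebesgue_measure R).
Implicit Types z : lattice.

Let cell (rho : R) (n : nat) : set R := `[n%:R / rho, n.+1%:R / rho[%classic.

Let cellP (rho : R) n s : 0 < rho -> cell rho n s -> Num.truncn (rho * s) = n.
Proof.
move=> r0; rewrite /cell /= in_itv /= => /andP[a b]; apply: truncn_def.
by rewrite mulrC -ler_pdivrMr// a /= -ltr_pdivlMr.
Qed.

Let bigcup_cell (rho : R) : 0 < rho -> \bigcup_n cell rho n = `[0, +oo[%classic.
Proof.
move=> r0; apply/seteqP; split=> [s [n _]|s]; rewrite /cell /= !in_itv /=.
  by move=> /andP[a _]; rewrite andbT (le_trans _ a)// divr_ge0// ltW.
rewrite andbT => s0; exists (Num.truncn (rho * s)) => //=; rewrite in_itv /=.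
have := @truncn_itv R (rho * s); rewrite mulr_ge0 ?(ltW r0)// => /(_ isT).
by rewrite ler_pdivrMr// ltr_pdivlMr// [s * _]mulrC.
Qed.

Let measurable_step (a : nat -> R) (rho : R) : 0 < rho ->
  measurable_fun (`[0, +oo[%classic : set R) (fun s : R => a (Num.truncn (rho * s))).
Proof.
move=> r0; rewrite -(bigcup_cell r0); apply/measurable_fun_bigcup.
  by move=> n; exact: measurable_itv.
move=> n; apply: (eq_measurable_fun (cst (a n))).
  by move=> s; rewrite inE => /(cellP r0) ->.
exact: measurable_cst.
Qed.

(** A series becomes an integral over the half line, with time rescaled by [rho], so that dominated
    convergence can be applied. *)
Lemma integral_step (a : nat -> R) (rho : R) : (forall n, 0 <= a n) -> 0 < rho ->
  (\int[mu]_(s in `[0%R, +oo[) (rho * a (Num.truncn (rho * s)))%:E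
   = \sum_(n <oo) (a n)%:E)%E.
Proof.
move=> a0 r0; rewrite -(bigcup_cell r0) ge0_integral_bigcup//; first last.
- apply/trivIsetP => i j _ _; apply: contraNeq => /set0P[s [si sj]].
  by rewrite -(cellP r0 si) -(cellP r0 sj).
- by move=> s _; rewrite lee_fin mulr_ge0// ltW.
- rewrite bigcup_cell//; apply/measurable_EFinP; exact: (measurable_step (fun n => rho * a n)).
- by move=> n; exact: measurable_itv.
apply: eq_eseriesr => n _.
transitivity (\int[mu]_(s in cell rho n) (rho * a n)%:E)%E.
  by apply: eq_integral => s; rewrite inE => /(cellP r0) ->.
rewrite integral_cst; last exact: measurable_itv.
transitivity ((rho * a n)%:E * (rho^-1)%:E)%E; last first.
  by rewrite -EFinM mulrAC mulfV ?mul1r// gt_eqF.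
congr (_ * _)%E.
have := lebesgue_measure_itv (`[n%:R / rho, n.+1%:R / rho[ : interval R).
rewrite /= lte_fin ltr_pM2r ?invr_gt0// ltr_nat ltnSn => e.
by apply: (etrans e); rewrite -EFinB -mulrBl -natrB// subSnn mul1r.
Qed.

Lemma green_series z : ((green z)%:E = \sum_(n <oo) (heat n z)%:E)%E.
Proof.
rewrite /green -EFin_lim; last exact: cvg_series_heat.
by apply: congr_lim; apply/funext => m /=; rewrite seriesEnat /= sumEFin.
Qed.

(* Time is rescaled by [nsq z], so that [lnorm z * green z] is the integral of
   [profile z] and [profile z] has a pointwise limit as [z] tends to infinity. *)
Definition profile z (s : R) : R := lnorm z ^+ 3 * heat (Num.truncn (nsq z * s)) z.

Let lnorm_nsq z : nsq z != 0 -> 0 < lnorm z.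
Proof. by move=> z0; rewrite sqrtr_gt0 lt_neqAle eq_sym z0 nsq_ge0. Qed.

Let lnorm0 z : nsq z = 0 -> lnorm z = 0.
Proof. by move=> z0; rewrite /lnorm z0 sqrtr0. Qed.

Lemma integral_profile z :
  (\int[mu]_(s in `[0%R, +oo[) (profile z s)%:E = (lnorm z * green z)%:E)%E.
Proof.
have [z0|z0] := eqVneq (nsq z) 0.
  rewrite lnorm0// mul0r; apply: integral0_eq => s _.
  by rewrite /profile lnorm0// expr0n mul0r.
have q0 : 0 < nsq z by rewrite lt_neqAle eq_sym z0 nsq_ge0.
rewrite EFinM green_series -(integral_step (fun n => heat_ge0 n z) q0).
rewrite -ge0_integralZl_EFin//.
- by apply: eq_integral => s _; rewrite -EFinM mulrA -{1}lnorm_sqr -exprS.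
- by move=> s _; rewrite lee_fin mulr_ge0 ?nsq_ge0 ?heat_ge0.
- by apply/measurable_EFinP; exact: (measurable_step (fun n => nsq z * heat n z)).
- exact: sqrtr_ge0.
Qed.

Lemma measurable_profile z :
  measurable_fun (`[0, +oo[%classic : set R) (profile z).
Proof.
have [z0|z0] := eqVneq (nsq z) 0.
  apply: (eq_measurable_fun (cst (0 : R))); last exact: measurable_cst.
  by move=> s _; rewrite /profile lnorm0// expr0n mul0r.
have q0 : 0 < nsq z by rewrite lt_neqAle eq_sym z0 nsq_ge0.
exact: (measurable_step (fun n => lnorm z ^+ 3 * heat n z)).
Qed.

Lemma profile_ge0 z s : 0 <= profile z s.
Proof. by rewrite mulr_ge0 ?heat_ge0// exprn_ge0// sqrtr_ge0. Qed.

Lemma heat0 z : nsq z != 0 -> heat 0 z = 0.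
Proof.
move=> z0; rewrite /heat /=.
have [a0|_] := eqVneq z.1.1 0; last by rewrite !mul0r.
have [b0|_] := eqVneq z.1.2 0; last by rewrite mulr0 mul0r.
have [c0|_] := eqVneq z.2 0; last by rewrite mulr0.
by move: z0; rewrite /nsq a0 b0 c0 expr0n /= !addr0 eqxx.
Qed.

(** A majorant independent of [z]. The exponential in [heat_le] is a product of three equal factors,
    so the claim is the cube of [key]. *)
Lemma profile_le z s : 0 <= s ->
  profile z s <= 8 * wreturn (Num.truncn s) ^+ 3.
Proof.
move=> s0; have w0 n := @wreturn_gt0 R n.
have rhs0 : 0 <= 8 * wreturn (Num.truncn s) ^+ 3.
  by rewrite mulr_ge0// exprn_ge0// ltW.
have [z0|z0] := eqVneq (nsq z) 0.
  by rewrite /profile lnorm0// expr0n mul0r.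
have q0 : 0 < nsq z by rewrite lt_neqAle eq_sym z0 nsq_ge0.
have r0 := lnorm_nsq z0.
rewrite /profile; set n := Num.truncn _.
(* At time 0 the walk is still at the origin, so the profile vanishes; below, [n] may be divided
   by. *)
have [n0|n0] := posnP n; first by rewrite n0 heat0// mulr0.
have /andP[n1 n2] : n%:R <= nsq z * s < n.+1%:R.
  by apply: truncn_itv; rewrite mulr_ge0// nsq_ge0.
have nR : 0 < n%:R :> R by rewrite ltr0n.
have sp : 0 < s by rewrite -(pmulr_rgt0 s q0) (lt_le_trans nR).
(* After squaring, the left side is at most [s^-1 * (1 + s^-1 / 3)^-1 = 3/(3s+1)] and the right side
   at least [4/(4s+1)], by [wreturn_sqr_ge]. The exponential factor is what tames [s^-1] for small
   [s]. *)
have key : lnorm z * wreturn n * expR (- (nsq z / (6 * n%:R))) <= 2 * wreturn (Num.truncn s).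
  rewrite -(@ler_pXn2r _ 2) ?nnegrE//; last 2 first.
  - by rewrite !mulr_ge0 ?expR_ge0// ltW.
  - by rewrite mulr_ge0// ltW.
  rewrite !exprMn lnorm_sqr -expRM_natl.
  have h1 : nsq z * wreturn n ^+ 2 <= s^-1.
    rewrite -[leRHS]mul1r ler_pdivlMr// mulrAC.
    apply: le_trans (wreturn_sqr_le n); rewrite mulrC ler_wpM2l ?sqr_ge0//.
    by apply: (le_trans (ltW n2)); rewrite -natr1 lerD2r; lra.
  have h2 : expR (2%:R * - (nsq z / (6 * n%:R))) <= (1 + s^-1 / 3)^-1.
    rewrite mulrN expRN lef_pV2 ?posrE ?expR_gt0//; last first.
      by rewrite addr_gt0// divr_gt0// invr_gt0.
    apply: le_trans (expR_ge1Dx _); rewrite lerD2l.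
    have -> : 2 * (nsq z / (6 * n%:R)) = nsq z / n%:R / 3.
      by field; rewrite gt_eqF.
    by rewrite ler_pM2r ?invr_gt0// ler_pdivlMr// mulrC ler_pdivrMr.
  apply: (@le_trans _ _ (s^-1 * (1 + s^-1 / 3)^-1)).
    by apply: ler_pM; rewrite ?expR_ge0// mulr_ge0 ?nsq_ge0 ?sqr_ge0.
  have := wreturn_sqr_ge (R := R) (Num.truncn s).
  have /andP[k1 _] := truncn_itv s0.
  set w := wreturn _ ^+ 2 => h3.
  have w2 : 0 <= w by exact: sqr_ge0.
  have h4 : 1 <= w * (4 * s + 1) by apply: (le_trans h3); rewrite ler_wpM2l//; lra.
  have -> : s^-1 * (1 + s^-1 / 3)^-1 = 3 / (3 * s + 1).
    by field; rewrite !gt_eqF// ?addr_gt0 ?mulr_gt0 ?divr_gt0 ?invr_gt0//.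
  rewrite ler_pdivrMr; last by rewrite addr_gt0// mulr_gt0.
  nra.
apply: (@le_trans _ _ ((lnorm z * wreturn n * expR (- (nsq z / (6 * n%:R)))) ^+ 3)).
  rewrite !exprMn -expRM_natl -mulrA ler_wpM2l//; first by rewrite exprn_ge0// ltW.
  apply: (le_trans (heat_le z n0)).
  rewrite le_eqVlt; apply/orP; left; apply/eqP; congr (_ * expR _).
  by field; rewrite gt_eqF.
have -> : 8 * wreturn (Num.truncn s) ^+ 3 = (2 * wreturn (Num.truncn s)) ^+ 3.
  by rewrite exprMn; congr (_ * _); ring.
by rewrite lerXn2r ?nnegrE// ?mulr_ge0 ?expR_ge0// ltW.
Qed.

Let dom (s : R) : R := 8 * wreturn (Num.truncn s) ^+ 3.

Let integral_dom : (\int[mu]_(s in `[0%R, +oo[) (dom s)%:E <= 16%:E)%E.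
Proof.
have h n : 0 <= 8 * wreturn n ^+ 3 by rewrite mulr_ge0// exprn_ge0// ltW// wreturn_gt0.
rewrite (_ : integral _ _ _ = \sum_(n <oo) (8 * wreturn n ^+ 3)%:E)%E; last first.
  by rewrite -(integral_step h ltr01); apply: eq_integral => s _; rewrite !mul1r.
apply: lime_le; first by apply: is_cvg_nneseries => n _ _; rewrite lee_fin.
apply: nearW => m /=; rewrite sumEFin lee_fin -mulr_sumr.
have := @sum_cube_le R m; lra.
Qed.

Let measurable_dom : measurable_fun (`[0, +oo[%classic : set R) dom.
Proof.
have := measurable_step (fun n => 8 * wreturn n ^+ 3) (@ltr01 R).
by apply: eq_measurable_fun => s _; rewrite mul1r.
Qed.

Let itv0yP (s : R) : (`[0, +oo[%classic : set R) s -> 0 <= s.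
Proof. by rewrite /= in_itv/= andbT. Qed.

Lemma green_le z : lnorm z * green z <= 16.
Proof.
rewrite -lee_fin -integral_profile; apply: le_trans integral_dom.
apply: ge0_le_integral => //.
- by move=> s _; rewrite lee_fin profile_ge0.
- apply/measurable_EFinP; exact: measurable_profile.
- by apply/measurable_EFinP; exact: measurable_dom.
- by move=> s /itv0yP s0; rewrite lee_fin profile_le.
Qed.

(** The rescaled Gaussian heat kernel, the limit of [profile]. Since the inverse of 0 is 0, its
    value at [s = 0] is 0, as is that of [profile]. *)
Let phi (c s : R) : R := Num.sqrt (c / s) ^+ 3 * expR (- s^-1).

(** With [r = lnorm z] and [n] the integer part of [r^2 s], [n / r^2] tends to [s] and
    [lsup z / r^2] to 0. The bounds [heat_ge_sup] and [heat_le_sup] then have a common limit. *)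
Lemma profile_cvg (c : R) (z_ : nat -> lattice) (s : R) :
    (fun n : nat => n%:R * wreturn n ^+ 2) @ \oo --> c ->
    lnorm (z_ m) @[m --> \oo] --> +oo -> 0 <= s ->
  profile (z_ m) s @[m --> \oo] --> phi c s.
Proof.
move=> wc zoo; rewrite le_eqVlt => /predU1P[<-|s0].
  rewrite /phi invr0 mulr0 sqrtr0 expr0n mul0r.
  rewrite (_ : (fun m => _) = cst 0); first exact: cvg_cst.
  apply/funext => m; rewrite /profile mulr0 truncn0.
  have [q0|q0] := eqVneq (nsq (z_ m)) 0; first by rewrite lnorm0// expr0n mul0r.
  by rewrite heat0// mulr0.
pose r m := lnorm (z_ m).
pose n m := Num.truncn (nsq (z_ m) * s).
pose a m : R := (n m)%:R / r m ^+ 2.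
pose j m : R := (lsup (z_ m))%:R / r m ^+ 2.
have r1 : \forall m \near \oo, 1 <= r m by exact: (cvgryPge _).1 zoo 1.
have rV0 : (r m)^-1 @[m --> \oo] --> (0 : R).
  apply/gtr0_cvgV0 => //; apply: filterS r1 => m; exact: lt_le_trans.
have r2V0 : (r m ^+ 2)^-1 @[m --> \oo] --> (0 : R).
  rewrite (_ : (fun m => _) = (fun m => (r m)^-1 * (r m)^-1)).
    by rewrite -[0](mulr0 (0 : R)); exact: cvgM.
  by apply/funext => m; rewrite expr2 invfM.
have as_ : a m @[m --> \oo] --> s.
  apply: (@squeeze_cvgr _ _ _ _ (fun m => s - (r m ^+ 2)^-1) (fun=> s)).
  - near=> m.
    have rm : 1 <= r m by near: m.
    have q0 : 0 < r m ^+ 2 by rewrite exprn_gt0// (lt_le_trans ltr01).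
    have /andP[n1 n2] : (n m)%:R <= r m ^+ 2 * s < (n m).+1%:R.
      by rewrite /n -lnorm_sqr -/(r m) truncn_itv// mulr_ge0// ltW.
    rewrite /a ler_pdivrMr// [s * _]mulrC n1 andbT ler_pdivlMr// mulrBl mulVf ?gt_eqF//.
    by rewrite lerBlDr natr1 mulrC ltW.
  - by rewrite -[X in _ --> X](subr0 s); apply: cvgB; [exact: cvg_cst|].
  - exact: cvg_cst.
have j0 : j m @[m --> \oo] --> (0 : R).
  apply: (@squeeze_cvgr _ _ _ _ (fun=> 0) (fun m => (r m)^-1)) => //; last exact: cvg_cst.
  near=> m.
  have rm : 1 <= r m by near: m.
  have r0 : 0 < r m by rewrite (lt_le_trans ltr01).
  rewrite /j divr_ge0 ?sqr_ge0//= ler_pdivrMr ?exprn_gt0//.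
  by rewrite expr2 mulrA mulVf ?gt_eqF// mul1r lsup_le.
have noo : n m @[m --> \oo] --> \oo.
  apply/cvgnyPge => A.
  have : \forall m \near \oo, A%:R / s + 1 <= r m by exact: (cvgryPge _).1 zoo _.
  apply: filterS => m rm; rewrite /n truncn_ge_nat; last by rewrite mulr_ge0 ?nsq_ge0// ltW.
  rewrite -lnorm_sqr -/(r m) -ler_pdivrMr//.
  have := divr_ge0 (ler0n R A) (ltW s0); nra.
(* The square of the left side is [n * wreturn n ^+ 2], which tends to [c], divided by
   [a = n / r^2], which tends to [s]. *)
have rw : (r m * wreturn (n m)) @[m --> \oo] --> Num.sqrt (c / s).
  have : Num.sqrt (((n m)%:R * wreturn (n m) ^+ 2) / a m) @[m --> \oo] --> Num.sqrt (c / s).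
    apply: (@continuous_cvg _ _ _ _ _ _ (@Num.sqrt R)); first exact: sqrt_continuous.
    apply: cvgM; first exact: (cvg_comp n (fun n : nat => n%:R * wreturn n ^+ 2) noo wc).
    by apply: cvgV => //; rewrite gt_eqF.
  apply: cvg_trans; apply: near_eq_cvg; near=> m.
  have rm : 1 <= r m by near: m.
  have nm : (1 <= n m)%N by near: m; exact: (cvgnyPge _).1 noo 1%N.
  have r0 : 0 < r m by rewrite (lt_le_trans ltr01).
  rewrite -[RHS]ger0_norm ?mulr_ge0 ?(ltW r0) ?(ltW (wreturn_gt0 _))//.
  rewrite -sqrtr_sqr exprMn /a; congr Num.sqrt.
  by field; rewrite !gt_eqF// ltr0n.
have expc (b : nat -> R) : b m @[m --> \oo] --> s ->
    (r m * wreturn (n m)) ^+ 3 * expR (- (b m)^-1) @[m --> \oo] --> phi c s.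
  move=> bs; apply: cvgM; first by
    apply: (@continuous_cvg _ _ _ _ _ _ (fun x : R => x ^+ 3)) => //; exact: exprn_continuous.
  apply: (@continuous_cvg _ _ _ _ _ _ (@expR R)); first exact: continuous_expR.
  by apply: cvgN; apply: cvgV => //; rewrite gt_eqF.
apply: (@squeeze_cvgr _ _ _ _
  (fun m => (r m * wreturn (n m)) ^+ 3 * expR (- (a m - j m + (r m ^+ 2)^-1)^-1))
  (fun m => (r m * wreturn (n m)) ^+ 3 * expR (- (a m + j m)^-1))); last 2 first.
- apply: expc; rewrite -[X in _ --> X]addr0 -[X in _ --> X + _]subr0.
  by apply: cvgD => //; exact: cvgB.
- by apply: expc; rewrite -[X in _ --> X]addr0; exact: cvgD.
have s2 : 0 < s / 2 by rewrite divr_gt0.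
have s3 : s / 2 < s by lra.
near=> m.
have rm : 1 <= r m by near: m.
have r0 : 0 < r m by rewrite (lt_le_trans ltr01).
(* Required by [heat_ge_sup]; it holds eventually because [s / 2] separates the limits of [j] and
   [a]. *)
have jn : (lsup (z_ m) <= n m)%N.
  rewrite -(ler_nat R) -(@ler_pM2r _ (r m ^+ 2)^-1) ?invr_gt0 ?exprn_gt0// -/(j m) -/(a m).
  have : j m < s / 2 by near: m; exact: (cvgr_lt _ j0).
  have : s / 2 < a m by near: m; exact: (cvgr_gt _ as_).
  by move=> ? ?; rewrite ltW// (lt_trans _ (y := s / 2)).
have e1 : (a m - j m + (r m ^+ 2)^-1)^-1 = nsq (z_ m) / (n m - lsup (z_ m)).+1%:R.
  rewrite -lnorm_sqr -/(r m) -[RHS]invf_div; congr (_^-1).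
  by rewrite -natr1 natrB// !mulrDl mulNr mul1r.
have e2 : (a m + j m)^-1 = nsq (z_ m) / (n m + lsup (z_ m))%:R.
  by rewrite -lnorm_sqr -/(r m) -[RHS]invf_div natrD /a /j -mulrDl.
rewrite e1 e2 exprMn /profile -/(r m) -/(n m).
have r3 : 0 <= r m ^+ 3 by rewrite exprn_ge0// ltW.
apply/andP; split; [rewrite -[leLHS]mulrA|rewrite -[leRHS]mulrA]; apply: (ler_wpM2l r3).
- exact: heat_ge_sup.
- exact: heat_le_sup.
Unshelve. all: by end_near. Qed.

(** [kappa] is the integral of [phi c], reached by dominated convergence with majorant [dom]; as
    [phi] does not involve [z], the limit is the same in all directions. *)
Lemma green_cvg : exists2 kappa : R, 0 < kappa &
  forall z_ : nat -> lattice, lnorm (z_ m) @[m --> \oo] --> +oo ->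
    lnorm (z_ m) * green (z_ m) @[m --> \oo] --> kappa.
Proof.
have [c c0 wc] := @wreturn_cvg R.
pose pos : set R := `[0, +oo[%classic.
have mpos : measurable pos by exact: measurable_itv.
have idom : mu.-integrable pos (EFin \o dom).
  apply/integrableP; split; first by apply/measurable_EFinP; exact: measurable_dom.
  apply: le_lt_trans (ltry 16); apply: le_trans integral_dom.
  by under eq_integral do rewrite /= ger0_norm ?mulr_ge0 ?exprn_ge0 ?(ltW (wreturn_gt0 _))//.
have phi0 s : 0 <= phi c s by rewrite mulr_ge0 ?expR_ge0// exprn_ge0// sqrtr_ge0.
have limi (z_ : nat -> lattice) : lnorm (z_ m) @[m --> \oo] --> +oo ->
    (lnorm (z_ m) * green (z_ m))%:E @[m --> \oo] --> (\int[mu]_(s in pos) (phi c s)%:E)%E.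
  move=> zoo.
  rewrite (_ : (fun m => _) = (fun m => \int[mu]_(s in pos) (profile (z_ m) s)%:E)%E); last first.
    by apply/funext => m; rewrite integral_profile.
  apply: (@dominated_cvg _ _ _ mu _ mpos (fun m s => (profile (z_ m) s)%:E) _ (EFin \o dom)) => //.
  - by move=> m; apply/measurable_EFinP; exact: measurable_profile.
  - by move=> s /itv0yP s0; apply: cvg_EFin; [exact: nearW|exact: profile_cvg].
  - move=> m s /itv0yP s0; rewrite /= lee_fin ger0_norm ?profile_ge0//.
    exact: profile_le.
pose I := (\int[mu]_(s in pos) (phi c s)%:E)%E.
(* One explicit sequence tending to infinity: it makes [phi c] a limit of measurable functions and,
   through [green_le], its integral finite. *)
pose zz m : lattice := (m%:Z, 0, 0).
have zzoo : lnorm (zz m) @[m --> \oo] --> +oo.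
  rewrite (_ : (fun m => _) = (fun m : nat => m%:R : R)); first exact: cvgr_idn.
  apply/funext => m; rewrite /lnorm /nsq /= expr0n !addr0 sqrtr_sqr.
  by rewrite ger0_norm.
have mphi : measurable_fun pos (phi c).
  apply: (@measurable_fun_cvg _ _ _ _ (fun m => profile (zz m))).
    by move=> m; exact: measurable_profile.
  by move=> s /itv0yP s0; exact: profile_cvg.
have I16 : (I <= 16%:E)%E.
  rewrite (_ : I = limn (fun m => (lnorm (zz m) * green (zz m))%:E)); last first.
    by apply/esym/cvg_lim => //; exact: limi.
  apply: lime_le; first by apply/cvg_ex; exists I; exact: limi.
  by apply: nearW => m; rewrite lee_fin green_le.
(* On [[1, 2]] the function [phi c] is at least [d]. *)
have I0 : (0 < I)%E.
  pose d := Num.sqrt (c / 2) ^+ 3 * expR (- 1).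
  have d0 : 0 < d by rewrite mulr_gt0 ?expR_gt0// exprn_gt0// sqrtr_gt0 divr_gt0.
  pose J : set R := `[1, 2]%classic.
  have mJ : measurable J by exact: measurable_itv.
  have Jpos : J `<=` pos.
    by move=> s; rewrite /J /pos /= !in_itv/= andbT => /andP[s1 _]; exact: le_trans s1.
  have -> : 0%E = 0%:E :> \bar R by [].
  apply: (@lt_le_trans _ _ d%:E); first by rewrite lte_fin.
  apply: (@le_trans _ _ (\int[mu]_(s in J) (phi c s)%:E)%E); last first.
    apply: ge0_subset_integral => //; first exact/measurable_EFinP.
    by move=> s _; rewrite lee_fin.
  have -> : d%:E = (\int[mu]_(s in J) (cst d%:E) s)%E.
    rewrite integral_cst//.
    have := lebesgue_measure_itv (`[1, 2] : interval R).
    rewrite /= lte_fin ltr1n -EFinB => e.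
    by rewrite [X in (_ * X)%E]e -EFinM (_ : 2 - 1 = 1) ?mulr1//; ring.
  apply: ge0_le_integral => //.
  - by move=> s _; rewrite lee_fin ltW.
  - by apply/measurable_EFinP; exact: measurable_funS mphi.
  - move=> s; rewrite /J /= in_itv/= => /andP[s1 s2].
    have s0 : 0 < s by exact: lt_le_trans s1.
    rewrite lee_fin ler_pM ?expR_ge0 ?exprn_ge0 ?sqrtr_ge0//.
      rewrite lerXn2r ?nnegrE ?sqrtr_ge0// ler_wsqrtr// ler_wpM2l ?(ltW c0)//.
      by rewrite lef_pV2 ?posrE.
    by rewrite ler_expR lerN2 invf_le1.
exists (fine I).
  by rewrite fine_gt0// I0 (le_lt_trans I16)// ltry.
move=> z_ zoo; have := limi _ zoo.
rewrite -/I -[I]fineK; last first.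
  by rewrite ge0_fin_numE ?(ltW I0)// (le_lt_trans I16)// ltry.
by move/fine_cvgP => [_].
Qed.

End green_asymptotics.

(** * Sublevel sets of functions on the lattice *)

Section sublevel.
Context {R : realType}.

(* Among all finite sets of the same cardinality, a sublevel set minimises the sum. *)
Lemma sum_sublevel_le_shift (V : zmodType) (U : V -> R) (l : R) (S : seq V) (e : V) :
  uniq S -> (forall z, (z \in S) = (U z <= l)) ->
  \sum_(z <- S) U z <= \sum_(z <- S) U (z + e).
Proof.
move=> uS SP.
(* Both sums have equally many terms, so [l] may be subtracted. Then terms in [S] are [<= 0] and
   terms outside are positive: passing from [S] to its translate loses the former and gains the
   latter. *)
suff : \sum_(z <- S) (U z - l) <= \sum_(z <- S) (U (z + e) - l).
  by rewrite !big_split /= lerD2r.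
pose T := [seq z + e | z <- S].
have uT : uniq T by rewrite map_inj_uniq//; exact: addIr.
rewrite -(big_map (+%R^~ e) predT (fun w => U w - l)) -/T.
apply: (@le_trans _ _ (\sum_(w <- T | w \in S) (U w - l))); last first.
  rewrite [leRHS](bigID (mem S))/= lerDl; apply: sumr_ge0 => w.
  by rewrite SP -ltNge subr_ge0 => /ltW.
have -> : \sum_(w <- T | w \in S) (U w - l) = \sum_(w <- S | w \in T) (U w - l).
  rewrite -big_filter -[RHS]big_filter; apply/perm_big/uniq_perm; rewrite ?filter_uniq//.
  by move=> w; rewrite !mem_filter andbC.
rewrite [leLHS](bigID (mem T))/= gerDl big_seq_cond; apply: sumr_le0 => w.
by rewrite SP => /andP[h _]; rewrite subr_le0.
Qed.

(** The average over the steps, with weights of total mass 1, of [sum_sublevel_le_shift]. *)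
Lemma sum_sublevel_laverage (U : lattice -> R) (l : R) (S : seq lattice) :
  uniq S -> (forall z, (z \in S) = (U z <= l)) ->
  \sum_(z <- S) (U z - laverage U z) <= 0.
Proof.
move=> uS SP; rewrite sumrB subr_le0 /laverage exchange_big /=.
rewrite -[leLHS]mul1r -(@sum_weight R) big_distrl /=; apply: ler_sum => e _.
rewrite -mulr_sumr ler_wpM2l ?weight_ge0//.
exact: sum_sublevel_le_shift SP.
Qed.

Lemma finite_lnorm (M : R) : finite_set [set z : lattice | lnorm z <= M].
Proof.
pose k := Num.truncn M.
pose I : set int := [set j | `|j| <= k%:Z].
have fI : finite_set I.
  apply: (@sub_finite_set _ _ ((fun i : nat => i%:Z - k%:Z) @` `I_(k + k).+1)).
    move=> j; rewrite /I /= => jk; exists (absz (j + k%:Z)); rewrite /=; lia.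
  exact/finite_image/finite_II.
apply: (@sub_finite_set _ _ (I `*` I `*` I)); last exact/finite_setX/fI/finite_setX.
move=> [[a b] c] zM.
have : (lsup (a, b, c))%:R <= M := le_trans (lsup_le (a, b, c)) zM.
have M0 : 0 <= M by apply: le_trans zM; exact: sqrtr_ge0.
rewrite -truncn_ge_nat// -/k /lsup /= => h; rewrite /I /=; split => /=; [split => /=|]; lia.
Qed.

End sublevel.

(** * The area of a surface in a ball *)

Section enorm_theory.
Context {R : realType} {n : nat}.
Implicit Types x y z : 'rV[R]_n.

Lemma enorm_ge0 x : 0 <= enorm x. Proof. exact: sqrtr_ge0. Qed.

Lemma enorm_sqr x : enorm x ^+ 2 = \sum_(i < n) x ord0 i ^+ 2.
Proof. by rewrite sqr_sqrtr// sumr_ge0// => i _; exact: sqr_ge0. Qed.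

Lemma enorm0 : enorm (0 : 'rV[R]_n) = 0.
Proof.
rewrite /enorm big1 ?sqrtr0// => i _.
by rewrite mxE expr0n.
Qed.

Lemma enormN x : enorm (- x) = enorm x.
Proof. by congr Num.sqrt; apply: eq_bigr => i _; rewrite mxE sqrrN. Qed.

Lemma enormZ (a : R) x : enorm (a *: x) = `|a| * enorm x.
Proof.
rewrite /enorm (eq_bigr (fun i => a ^+ 2 * x ord0 i ^+ 2)); last first.
  by move=> i _; rewrite mxE exprMn.
by rewrite -mulr_sumr sqrtrM ?sqr_ge0// sqrtr_sqr.
Qed.

Lemma enormC x y : enorm (x - y) = enorm (y - x).
Proof. by rewrite -opprB enormN. Qed.

Lemma coord_le_enorm x i : `|x ord0 i| <= enorm x.
Proof.
rewrite -sqrtr_sqr ler_sqrt ?sumr_ge0//; last by move=> j _; exact: sqr_ge0.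
by rewrite (bigD1 i)//= lerDl sumr_ge0// => j _; exact: sqr_ge0.
Qed.

Lemma enorm_eq0 x : enorm x = 0 -> x = 0.
Proof.
move=> x0; apply/rowP => i; rewrite mxE; apply/eqP; rewrite -normr_le0.
by rewrite -x0 coord_le_enorm.
Qed.

Lemma enorm_le_sum x : enorm x <= \sum_i `|x ord0 i|.
Proof.
have S0 (s : seq 'I_n) : 0 <= \sum_(i <- s) `|x ord0 i| by rewrite sumr_ge0.
rewrite -[leRHS]ger0_norm// -sqrtr_sqr; apply: ler_wsqrtr.
elim: (index_enum _) => [|i s IH]; first by rewrite !big_nil expr0n.
rewrite !big_cons sqrrD real_normK ?num_real// -addrA lerD2l (le_trans IH)//.
by rewrite lerDr mulrn_wge0// mulr_ge0.
Qed.

Lemma enormD x y : enorm (x + y) <= enorm x + enorm y.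
Proof.
rewrite -(@ler_pXn2r _ 2) ?nnegrE ?addr_ge0 ?enorm_ge0//.
rewrite sqrrD !enorm_sqr.
have -> : \sum_(i < n) (x + y) ord0 i ^+ 2 =
    \sum_(i < n) x ord0 i ^+ 2 + (\sum_(i < n) x ord0 i * y ord0 i) *+ 2
    + \sum_(i < n) y ord0 i ^+ 2.
  by rewrite -sumrMnl -!big_split /=; apply: eq_bigr => i _; rewrite mxE sqrrD.
rewrite lerD2r lerD2l lerMn2r/=; apply: (le_trans (ler_norm _)).
rewrite -(@ler_pXn2r _ 2) ?nnegrE ?mulr_ge0 ?enorm_ge0//.
rewrite real_normK ?num_real// exprMn !enorm_sqr -subr_ge0.
(* Lagrange's identity *)
suff -> : (\sum_(i < n) x ord0 i ^+ 2) * (\sum_(i < n) y ord0 i ^+ 2) -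
    (\sum_(i < n) x ord0 i * y ord0 i) ^+ 2 =
    2^-1 * \sum_(i < n) \sum_(j < n) (x ord0 i * y ord0 j - x ord0 j * y ord0 i) ^+ 2.
  rewrite mulr_ge0 ?invr_ge0// sumr_ge0// => i _; rewrite sumr_ge0// => j _.
  exact: sqr_ge0.
set X := \sum_i x ord0 i ^+ 2; set Y := \sum_i y ord0 i ^+ 2.
set S := \sum_i x ord0 i * y ord0 i.
suff -> : \sum_(i < n) \sum_(j < n) (x ord0 i * y ord0 j - x ord0 j * y ord0 i) ^+ 2
    = X * Y + X * Y - 2 * (S * S) by field.
transitivity (\sum_(i < n) (x ord0 i ^+ 2 * Y + X * y ord0 i ^+ 2
    - 2 * (x ord0 i * y ord0 i * S))).
  apply: eq_bigr => i _; rewrite /X /Y /S !mulr_sumr mulr_suml -big_split -sumrB /=.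
  by apply: eq_bigr => j _; ring.
by rewrite sumrB big_split /= -mulr_suml -mulr_sumr -mulr_sumr -mulr_suml.
Qed.

Lemma ler_enorm_sub x y : `|enorm x - enorm y| <= enorm (x - y).
Proof.
rewrite ler_norml lerBDl lerBlDl -[X in X - _ <= _]enormN.
have := enormD (x - y) y; have := enormD (y - x) x; rewrite !subrK enormN [enorm (y - x)]enormC.
lra.
Qed.

End enorm_theory.

Section enorm_topology.
Context {R : realType} {n : nat}.
Implicit Types x y : 'rV[R]_n.

Lemma enorm_lt_ball x y (e : R) : enorm (x - y) < e -> ball x e y.
Proof.
move=> xy; split; first by apply: le_lt_trans xy; exact: enorm_ge0.
move=> i j; rewrite ord1 /ball /=; apply: le_lt_trans xy.
by have := coord_le_enorm (x - y) j; rewrite !mxE.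
Qed.

Lemma ball_enorm_le x y (e : R) : ball x e y -> enorm (x - y) <= n%:R * e.
Proof.
move=> [_ xy]; apply: (le_trans (enorm_le_sum _)).
rewrite mulr_natl -[n in _ *+ n]card_ord -sumr_const; apply: ler_sum => i _.
by have := ltW (xy ord0 i); rewrite !mxE.
Qed.

Lemma nbhs_enorm x (A : set 'rV[R]_n) : nbhs x A ->
  exists2 e : R, 0 < e & forall y, enorm (x - y) < e -> A y.
Proof.
move=> /nbhs_ballP[e /= e0 eA]; exists e => // y xy.
by apply: eA; exact: enorm_lt_ball.
Qed.

Lemma continuous_enorm_sub x : continuous (fun y => enorm (y - x)).
Proof.
move=> y; apply/(@cvgrPdist_le _ _ _ (nbhs y) (nbhs_filter y)) => e e0.
have d0 : 0 < e / n.+1%:R by rewrite divr_gt0.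
near=> z.
have /ball_enorm_le yz : ball y (e / n.+1%:R) z by near: z; exact: nbhsx_ballx.
 apply: (le_trans (ler_enorm_sub _ _)).
rewrite opprB addrA subrK; apply: (le_trans yz).
by rewrite mulrCA ler_piMr ?(ltW e0)// ler_pdivrMr// mul1r ler_nat.
Unshelve. all: by end_near. Qed.

End enorm_topology.

Definition eball (R : realType) n (p : 'rV[R]_n) (r : R) : set 'rV[R]_n :=
  [set u | enorm (u - p) < r].

(** * Measurability of closed sets for the Hausdorff measure *)

Section metric_outer_measure.
Context {R : realType}.
Local Open Scope ereal_scope.
Local Notation H := (@hausdorff2 R).
Implicit Types A B X F : set 'rV[R]_3.

Lemma enorm_le_ediam (U : set 'rV[R]_3) x y : U x -> U y -> (enorm (x - y))%:E <= ediam U.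
Proof.
move=> Ux Uy; rewrite /ediam le_max; apply/orP; right.
by apply: ereal_sup_ubound; exists x => //; exists y.
Qed.

(** A set of diameter at most [delta < d] cannot meet both [A] and [B], so each piece of a cover of
    the union is charged to at most one of the covers [G A] and [G B]. *)
Lemma hausdorff2_pre_separated (delta d : R) A B : (delta < d)%R ->
  (forall x y, A x -> B y -> (d <= enorm (x - y))%R) ->
  hausdorff2_pre delta A + hausdorff2_pre delta B <= hausdorff2_pre delta (A `|` B).
Proof.
move=> dd sep; apply: le_ereal_inf_tmp => _ [F [dF ABF] <-].
pose G (C : set 'rV[R]_3) k := if `[< F k `&` C !=set0 >] then F k else set0.
have GF C : C `<=` A `|` B -> fine_cover delta C (G C).
  move=> CAB; split => [k|x Cx].
    rewrite /G; case: asboolP => _ //; rewrite ediam0.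
    exact: le_trans (ediam_ge0 _) (dF k).
  have [k _ Fkx] := ABF x (CAB x Cx).
  by exists k => //; rewrite /G; case: asboolP => // -[]; exists x.
have pre_le C : C `<=` A `|` B ->
    hausdorff2_pre delta C <= \sum_(k <oo) hausdorff2_size (G C k).
  by move=> /GF GC; apply: ereal_inf_lbound; exists (G C).
apply: (le_trans (leeD (pre_le A (@subsetUl _ _ _)) (pre_le B (@subsetUr _ _ _)))).
rewrite -nneseriesD//; try by move=> *; exact: hausdorff2_size_ge0.
apply: lee_nneseries => [k _ _|k _].
  by rewrite adde_ge0 ?hausdorff2_size_ge0.
rewrite /G; case: asboolP => [[x [Fx Ax]]|_]; last first.
  by rewrite hausdorff2_size0 add0e; case: asboolP => _//; rewrite hausdorff2_size0 hausdorff2_size_ge0.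
case: asboolP => [[y [Fy By]]|_]; last by rewrite hausdorff2_size0 adde0.
have := le_trans (enorm_le_ediam Fx Fy) (dF k).
by rewrite lee_fin leNgt (lt_le_trans dd)// sep.
Qed.

Lemma le_hausdorff2_pre_delta (d1 d2 : R) A : (d1 <= d2)%R ->
  hausdorff2_pre d2 A <= hausdorff2_pre d1 A.
Proof.
move=> d12; apply: le_ereal_inf_tmp => _ [F [dF AF] <-].
apply: ereal_inf_lbound; exists F => //; split => // k.
by apply: (le_trans (dF k)); rewrite lee_fin.
Qed.

Lemma hausdorff2_pre_le (d : R) A : (0 < d)%R -> hausdorff2_pre d A <= H A.
Proof. by move=> d0; apply: ereal_sup_ubound; exists d. Qed.

Lemma hausdorff2_separated (d : R) A B : (0 < d)%R ->
  (forall x y, A x -> B y -> (d <= enorm (x - y))%R) ->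
  H A + H B <= H (A `|` B).
Proof.
move=> d0 sep.
have [->|fAB] := eqVneq (H (A `|` B)) +oo; first by rewrite leey.
have fin C : C `<=` A `|` B -> H C \is a fin_num.
  move=> CAB; rewrite ge0_fin_numE ?hausdorff2_ge0//.
  by apply: (le_lt_trans (le_hausdorff2 CAB)); rewrite ltey.
have fA := fin A (@subsetUl _ _ _); have fB := fin B (@subsetUr _ _ _).
rewrite -leeBrDr//; apply: ge_ereal_sup => _ [d1 d10 <-].
rewrite leeBrDr// addeC -leeBrDr; last first.
  rewrite ge0_fin_numE ?hausdorff2_pre_ge0//.
  by apply: (le_lt_trans (hausdorff2_pre_le A d10)); rewrite ltey; case: (H A) fA.
apply: ge_ereal_sup => _ [d2 d20 <-].
rewrite leeBrDr; last first.
  rewrite ge0_fin_numE ?hausdorff2_pre_ge0//.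
  by apply: (le_lt_trans (hausdorff2_pre_le A d10)); rewrite ltey; case: (H A) fA.
(* A common scale, finer than both given ones and below [d], at which the separated case applies. *)
pose e := Num.min (Num.min d1 d2) (d / 2)%R.
have e0 : (0 < e)%R by rewrite !lt_min d10 d20 divr_gt0.
apply: (@le_trans _ _ (hausdorff2_pre e A + hausdorff2_pre e B)).
  rewrite addeC; apply: leeD; apply: le_hausdorff2_pre_delta.
    by rewrite !ge_min lexx.
  by rewrite !ge_min lexx orbT.
apply: le_trans (hausdorff2_pre_le (A `|` B) e0).
apply: (@hausdorff2_pre_separated _ d) => //.
by rewrite !gt_min; apply/orP; right; lra.
Qed.

(* Caratheodory's criterion: [X `\` F] is exhausted by its parts [A k] at distance at
   least [1 / (k + 1)] from [F], and the rings [A k.+2 `\` A k.+1] have finite total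
   measure because each is separated from [A k]. *)
Lemma closed_caratheodory F : closed F -> (hausdorff2_outer R).-caratheodory F.
Proof.
move=> cF; apply: le_caratheodory_measurable => X.
change (H (X `&` F) + H (X `&` ~` F) <= H X).
have [->|fX] := eqVneq (H X) +oo; first by rewrite leey.
have finX : H X \is a fin_num by rewrite ge0_fin_numE ?hausdorff2_ge0// ltey.
pose A k := [set x | X x /\ forall w, F w -> (k.+1%:R^-1 <= enorm (x - w))%R].
have AX k : A k `<=` X by move=> x [].
have HAX k : H (A k) <= H X by exact: le_hausdorff2.
have Amono k l : (k <= l)%N -> A k `<=` A l.
  move=> kl x [Xx Ax]; split => // w Fw; apply: le_trans (Ax w Fw).
  by rewrite lef_pV2 ?posrE// ler_nat.
pose Q k := A k.+2 `\` A k.+1.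
(* A point of [Q k] is closer than [1/(k+2)] to some point of [F], whereas points of [A k] keep
   distance [1/(k+1)] from [F]. *)
have sepQ k : H (A k) + H (Q k) <= H (A k.+2).
  apply: (@le_trans _ _ (H (A k `|` Q k))); last first.
    by apply: le_hausdorff2 => x [/(@Amono k k.+2 (leqW (leqnSn k)))|[]].
  apply: (@hausdorff2_separated (k.+1%:R^-1 - k.+2%:R^-1)).
    by rewrite subr_gt0 ltf_pV2 ?posrE// ltr_nat.
  move=> x y [Xx Ax] [[Xy _]] /not_andP[//|/existsNP[w /not_implyP[Fw /negP]]].
  rewrite -ltNge => yw; have xw := Ax w Fw.
  have : (enorm (x - w) <= enorm (x - y) + enorm (y - w))%R.
    by apply: le_trans (enormD _ _); rewrite addrA subrK.
  by rewrite lerBlDr => t; apply: (le_trans xw); apply: (le_trans t); rewrite lerD2l ltW.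
(* [sepQ] raises the index by two, so the rings of even and of odd index telescope separately. *)
have sumQ n : \sum_(0 <= k < n) H (Q k) <= H (A n) + H (A n.+1).
  elim: n => [|n IH]; first by rewrite big_geq// adde_ge0 ?hausdorff2_ge0.
  rewrite big_nat_recr//=; apply: (le_trans (leeD2r _ IH)).
  by rewrite [H (A n) + _]addeC -addeA leeD2l.
have sumQoo : \sum_(k <oo) H (Q k) < +oo.
  apply: (@le_lt_trans _ _ (H X + H X)); last by rewrite lte_add_pinfty// ltey.
  apply: lime_le; first by apply: is_cvg_nneseries => k _ _; exact: hausdorff2_ge0.
  by apply: nearW => n; apply: (le_trans (sumQ n)); exact: leeD.
have tail : \sum_(n <= k <oo) H (Q k) @[n --> \oo] --> 0.
  by apply: nneseries_tail_cvg => // k _; exact: hausdorff2_ge0.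
have key n : H (X `&` F) + H (X `&` ~` F) <= H X + \sum_(n <= k <oo) H (Q k).
  apply: (@le_trans _ _ (H (X `&` F) + (H (A n.+1) + \sum_(n <= k <oo) H (Q k)))).
    apply: leeD2l; apply: (@le_trans _ _ (H (A n.+1 `|` \bigcup_(k in ~` `I_n) Q k))).
      apply: le_hausdorff2 => x [Xx nFx].
      have [k Akx] : exists k, A k x.
        have : nbhs x (~` F) by apply: open_nbhs_nbhs; split => //; exact: closed_openC.
        move=> /nbhs_enorm[e e0 exF].
        exists (Num.truncn e^-1); split => // w Fw; rewrite leNgt; apply/negP => xw.
        apply: (exF w) => //; apply: (lt_trans xw).
        by rewrite invf_plt ?posrE// truncnS_gt.
      (* The first index at which [x] enters the chain [A] decides between [A n.+1] and one of the
         rings from [Q n] on. *)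
      elim: k Akx => [|k IH] Akx; first by left; exact: (Amono 0%N).
      have [/IH//|nAk] := pselect (A k x).
      have [kn|nk] := leqP k n; first by left; exact: (Amono k.+1).
      right; case: k nk Akx nAk {IH} => // k nk Akx nAk; exists k => //=.
      by apply/negP; rewrite -leqNgt.
    apply: (le_trans (outer_measureU2 (hausdorff2_outer R) _ _)); apply: leeD2l.
    exact: outer_measure_sigma_subadditive_tail.
  rewrite addeA leeD2r//; apply: (@le_trans _ _ (H (X `&` F `|` A n.+1))); last first.
    by apply: le_hausdorff2 => x [[]//|/AX].
  apply: (@hausdorff2_separated n.+2%:R^-1); first by rewrite invr_gt0.
  by move=> x y [_ Fx] [_ Ay]; rewrite enormC; exact: Ay.
have : H X + \sum_(n <= k <oo) H (Q k) @[n --> \oo] --> H X + 0.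
  by apply: cvgeD => //; [rewrite fin_num_adde_defl|exact: cvg_cst].
by rewrite adde0; apply: cvge_ge; exact: nearW.
Qed.

Lemma measurable_closed F : closed F -> measurable (F : set (R3 R)).
Proof. exact: closed_caratheodory. Qed.

Lemma measurable_open F : open F -> measurable (F : set (R3 R)).
Proof. by move=> oF; rewrite -[F]setCK; apply: measurableC; apply: measurable_closed; exact: open_closedC. Qed.

Lemma continuous_measurable_R3 (f : 'rV[R]_3 -> R) : continuous f ->
  measurable_fun setT (f : R3 R -> R).
Proof.
move=> cf; apply: (measurability _ (RGenOInfty.measurableE R)) => _ [_ [x ->] <-].
rewrite setTI; apply: measurable_open; apply: open_comp; first by move=> y _; exact: cf.
exact: interval_open.
Qed.


End metric_outer_measure.

(** * Quadratic area growth, from Lipschitz graphs to compact surfaces *)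

Section surface_growth.
Context {R : realType}.
Local Notation H := (@hausdorff2 R).

(** [E] is a Lipschitz image of part of a square of side [r]. Cutting the square into [M * M] cells
    of side [h = r / M] covers [E] by sets of diameter at most [2 L h], whose total size
    [M^2 (pi/4) (2 L h)^2] does not depend on [M]. *)
Lemma hausdorff2_le_square (E : set 'rV[R]_3) (p1 p2 : 'rV[R]_3 -> R) (L r a1 a2 : R) :
  0 <= L -> 0 < r ->
  (forall u, E u -> a1 <= p1 u < a1 + r /\ a2 <= p2 u < a2 + r) ->
  (forall u v, E u -> E v -> enorm (u - v) <= L * (`|p1 u - p1 v| + `|p2 u - p2 v|)) ->
  (H E <= (pi * (L * r) ^+ 2)%:E)%E.
Proof.
move=> L0 r0 Esq Elip; apply: ge_ereal_sup => _ [delta d0 <-].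
pose M := (Num.truncn (2 * L * r / delta)).+1.
have M0 : 0 < M%:R :> R by rewrite ltr0n.
have Md : 2 * (L * r / M%:R) <= delta.
  by rewrite !mulrA ler_pdivrMr// [leRHS]mulrC -ler_pdivrMr// ltW// truncnS_gt.
have [h hE h0] : exists2 h, h = r / M%:R & 0 < h.
  by exists (r / M%:R); rewrite ?divr_gt0.
pose idx a (y : R) := Num.truncn ((y - a) / h).
have idxP a y y' : a <= y -> a <= y' -> idx a y = idx a y' -> `|y - y'| <= h.
  have tr b : a <= b -> (idx a b)%:R <= (b - a) / h < (idx a b).+1%:R.
    by move=> ab; apply: truncn_itv; rewrite divr_ge0 ?subr_ge0 ?(ltW h0).
  move=> /tr + /tr + e; rewrite e.
  rewrite !ler_pdivlMr// !ltr_pdivrMr// => /andP[u1 u2] /andP[u3 u4].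
  rewrite -natr1 mulrDl mul1r in u2 u4; rewrite ler_norml; apply/andP; split; lra.
have idxM a y : a <= y < a + r -> (idx a y < M)%N.
  move=> /andP[ay yr]; rewrite /idx truncn_lt_nat ?divr_ge0 ?subr_ge0 ?(ltW h0)//.
  rewrite ltr_pdivrMr// hE mulrCA mulfV ?gt_eqF// mulr1; lra.
(* The two cell indices are the quotient and remainder of [k] by [M]; further pieces are empty. *)
pose F k := if (k < M * M)%N then [set u | E u /\ idx a1 (p1 u) = (k %/ M)%N
    /\ idx a2 (p2 u) = (k %% M)%N] else set0.
have dF k : (ediam (F k) <= (2 * (L * h))%:E)%E.
  have p : 0 <= 2 * (L * h) by rewrite !mulr_ge0// ltW.
  rewrite /F; case: ifP => _; last by rewrite ediam0 lee_fin.
  rewrite /ediam ge_max lee_fin p /=; apply: ge_ereal_sup => _ [u [Eu [u1 u2]] [v [Ev [v1 v2]] <-]].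
  have [/andP[a1u _] /andP[a2u _]] := Esq u Eu.
  have [/andP[a1v _] /andP[a2v _]] := Esq v Ev.
  rewrite lee_fin (le_trans (Elip u v Eu Ev))// mulrCA ler_wpM2l//.
  rewrite mulr_natl mulr2n; apply: lerD.
    by apply: (idxP a1) => //; rewrite u1 v1.
  by apply: (idxP a2) => //; rewrite u2 v2.
apply: (@le_trans _ _ (\sum_(k <oo) hausdorff2_size (F k))%E).
  apply: ereal_inf_lbound; exists F => //; split.
    by move=> k; apply: (le_trans (dF k)); rewrite lee_fin hE [L * (_ / _)]mulrA.
  move=> u Eu; have [/idxM i1 /idxM i2] := Esq u Eu.
  exists (idx a1 (p1 u) * M + idx a2 (p2 u))%N => //.
  rewrite /F ifT; last first.
    by apply: (@leq_trans ((idx a1 (p1 u)).+1 * M)); rewrite ?leq_mul2r ?i1 ?orbT// mulSn addnC ltn_add2r.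
  by split => //; rewrite divnMDl// modnMDl divn_small// modn_small// addn0.
have F0 k : (M * M <= k)%N -> hausdorff2_size (F k) = 0%E.
  by move=> Mk; rewrite /F ltnNge Mk /= hausdorff2_size0.
rewrite (nneseries_split 0 (M * M)); last by move=> k _; exact: hausdorff2_size_ge0.
rewrite [X in (_ + X)%E]eseries0 ?adde0 ?add0n; last by move=> k /F0.
have sz k : (hausdorff2_size (F k) <= (pi / 4 * (2 * (L * h)) ^+ 2)%:E)%E.
  rewrite EFinM EFin_expe; apply: lee_wpmul2l; first by rewrite lee_fin divr_ge0 ?pi_ge0.
  by rewrite !expe2; apply: lee_pmul => //; exact: ediam_ge0.
apply: (@le_trans _ _ (\sum_(0 <= k < M * M) (pi / 4 * (2 * (L * h)) ^+ 2)%:E)%E).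
  by apply: lee_sum => k _; exact: sz.
rewrite sumEFin lee_fin sumr_const_nat subn0 hE -[leLHS]mulr_natr natrM.
by rewrite le_eqVlt; apply/orP; left; apply/eqP; field; rewrite gt_eqF.
Qed.

End surface_growth.

Section gradient_bound.
Context {R : realType}.

(** The mean value theorem along the segment from [w] to [z], which stays in the ball by
    convexity. *)
Lemma gradient_lipschitz n (g : 'rV[R]_n.+1 -> R) (r M : R) :
  (forall z, enorm z < r -> differentiable g z) ->
  (forall z i, enorm z < r -> `|'D_(delta_mx ord0 i) g z| <= M) ->
  forall z w, enorm z < r -> enorm w < r ->
    `|g z - g w| <= M * \sum_i `|z ord0 i - w ord0 i|.
Proof.
move=> dg gM z w zr wr; pose v := z - w.
pose x (t : R) := w + t *: v.
have xr (t : R) : 0 <= t <= 1 -> enorm (x t) < r.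
  move=> /andP[t0 t1]; have -> : x t = t *: z + (1 - t) *: w.
    by rewrite /x /v scalerBr scalerBl scale1r addrCA addrA.
  apply: (le_lt_trans (enormD _ _)); rewrite !enormZ !ger0_norm ?subr_ge0//.
  have [->|tn0] := eqVneq t 0; first by rewrite mul0r add0r subr0 mul1r.
  have tp : 0 < t by rewrite lt_neqAle eq_sym tn0.
  have : t * enorm z < t * r by rewrite ltr_pM2l.
  have : (1 - t) * enorm w <= (1 - t) * r by rewrite ler_wpM2l ?subr_ge0 ?(ltW wr).
  lra.
pose phi t := g (x t).
have dphi (t : R) : 0 <= t <= 1 -> is_derive t 1 phi ('D_v g (x t)).
  move=> /xr/dg dgx; have := diff_derivable (v := v) dgx.
  have e : (fun h : R => h^-1 *: ((phi \o shift t) (h *: 1) - phi t)) =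
      (fun h : R => h^-1 *: ((g \o shift (x t)) (h *: v) - g (x t))).
    apply/funext => h; congr (_ *: (g _ - _)).
    by rewrite /= /x scalerDl [h *: 1]mulr1 addrCA.
  move=> dv; have -> : 'D_v g (x t) = 'D_1 phi t by rewrite /derive e.
  have dp : derivable phi t 1 by rewrite /derivable e.
  exact: (DeriveDef dp erefl).
have cphi : {within `[0, 1], continuous phi}.
  apply: derivable_within_continuous => t; rewrite in_itv/= => /dphi h.
  exact: (@ex_derive _ _ _ _ _ _ _ h).
have p1 : phi 1 = g z by rewrite /phi /x scale1r /v addrC subrK.
have p0 : phi 0 = g w by rewrite /phi /x scale0r addr0.
have dphi' (t : R) : t \in `]0, 1[ -> is_derive t 1 phi ('D_v g (x t)).
  by move=> t01; apply: dphi; exact: subset_itv_oo_cc.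
have [t t01] := MVT ltr01 dphi' cphi.
rewrite p1 p0 subr0 mulr1 => ->.
have txr := xr t (subset_itv_oo_cc t01).
rewrite deriveE; last exact: dg.
rewrite [v]row_sum_delta linear_sum/= mulr_sumr; apply: (le_trans (ler_norm_sum _ _ _)).
apply: ler_sum => i _; rewrite linearZ/= normrM mulrC.
apply: ler_pM => //; last by rewrite !mxE.
by rewrite -deriveE; [exact: gM|exact: dg].
Qed.

End gradient_bound.

Section surface_local_growth.
Context {R : realType}.
Local Notation H := (@hausdorff2 R).

Lemma enorm_orthogonal n (Q : 'M[R]_n) (x : 'rV[R]_n) :
  Q *m Q^T = 1%:M -> enorm (x *m Q) = enorm x.
Proof.
move=> QQ; have e (y : 'rV[R]_n) : \sum_i y ord0 i ^+ 2 = (y *m y^T) ord0 ord0.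
  by rewrite mxE; apply: eq_bigr => i _; rewrite mxE expr2.
by rewrite /enorm !e trmx_mul mulmxA -(mulmxA x) QQ mulmx1.
Qed.

(** The Hoelder condition bounds the partial derivatives by their values at 0 plus [|K| rad^s], so
    points of the surface depend in a Lipschitz way on their first two coordinates in the frame [Q].
    These coordinates send a ball of radius [r] into a square of side [2r]. *)
Lemma C1_holder_local_growth (s : R) (S : set 'rV[R]_3) p : 0 < s ->
  C1_holder_surface s S -> S p ->
  exists (rad C : R), [/\ 0 < rad, 0 <= C & forall x r, 0 < r ->
    (H (S `&` eball p rad `&` eball x r) <= (C * r ^+ 2)%:E)%E].
Proof.
move=> s0 SC Sp; have [Q [rad [g [QQ rad0 dg [K gK] Sg]]]] := SC p Sp.
pose M := \sum_(i < 2) `|'D_(delta_mx ord0 i) g 0| + `|K| * rad `^ s.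
have gM z i : enorm z < rad -> `|'D_(delta_mx ord0 i) g z| <= M.
  move=> zr; rewrite -[X in `|X|](subrK ('D_(delta_mx ord0 i) g 0)).
  apply: (le_trans (ler_normD _ _)); rewrite addrC /M; apply: lerD.
    by rewrite (bigD1 i)//= lerDl sumr_ge0.
  apply: (le_trans (gK z 0 i zr _)); first by rewrite enorm0.
  rewrite subr0; apply: (le_trans (ler_wpM2r (powR_ge0 _ _) (ler_norm K))).
  apply: ler_wpM2l => //.
  by apply: ge0_ler_powR; rewrite ?nnegrE ?(ltW rad0) ?(ltW s0) ?enorm_ge0 ?(ltW zr).
have M0 : 0 <= M by rewrite addr_ge0 ?sumr_ge0// mulr_ge0// powR_ge0.
have glip := gradient_lipschitz dg gM.
pose Y u := (u - p) *m Q.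
pose c (i : 'I_2) u := Y u ord0 (lift ord_max i).
exists rad, (pi * ((1 + M) * 2) ^+ 2); split => //.
  by rewrite mulr_ge0 ?pi_ge0 ?sqr_ge0.
move=> x r r0.
have nY u v : enorm (u - v) = enorm (Y u - Y v).
  by rewrite /Y -mulmxBl opprB addrA subrK enorm_orthogonal.
have cY u v i : `|c i u - c i v| <= enorm (u - v).
  by have := coord_le_enorm (Y u - Y v) (lift ord_max i); rewrite -nY mxE [(- Y v) _ _]mxE.
have sum3 (f : 'I_3 -> R) : \sum_i f i = f (lift ord_max 0) + f (lift ord_max 1) + f ord_max.
  by rewrite !big_ord_recr big_ord0 /= add0r; congr (f _ + f _ + f _); apply: val_inj.
have sum2 (f : 'I_2 -> R) : \sum_i f i = f 0 + f 1.
  by rewrite !big_ord_recr big_ord0 /= add0r; congr (f _ + f _); apply: val_inj.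
have -> : pi * ((1 + M) * 2) ^+ 2 * r ^+ 2 = pi * ((1 + M) * (2 * r)) ^+ 2 by ring.
apply: (hausdorff2_le_square (p1 := c 0) (p2 := c 1) (a1 := c 0 x - r) (a2 := c 1 x - r)).
- by rewrite addr_ge0.
- by rewrite mulr_gt0.
- move=> u [_ /= ux].
  have := le_lt_trans (cY u x 0) ux; have := le_lt_trans (cY u x 1) ux.
  rewrite !ltr_norml => /andP[? ?] /andP[? ?]; split; apply/andP; split; lra.
- move=> u v [[Su /= up] _] [[Sv /= vp] _].
  rewrite nY; apply: (le_trans (enorm_le_sum _)); rewrite sum3.
  have gu : Y u ord0 ord_max = g (col' ord_max (Y u)) by have [+ _] := Sg u up; exact.
  have gv : Y v ord0 ord_max = g (col' ord_max (Y v)) by have [+ _] := Sg v vp; exact.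
  have colE (y : 'rV[R]_3) (i : 'I_2) : col' ord_max y ord0 i = y ord0 (lift ord_max i) by rewrite mxE.
  have colY w : enorm (w - p) < rad -> enorm (col' ord_max (Y w)) < rad.
    apply: le_lt_trans; rewrite -(enorm_orthogonal (w - p) QQ) -/(Y w).
    apply: ler_wsqrtr; rewrite sum3 sum2 !colE.
    by rewrite lerDl sqr_ge0.
  have := glip _ _ (colY u up) (colY v vp).
  rewrite -gu -gv sum2 !colE.
  have subE i : (Y u - Y v) ord0 i = Y u ord0 i - Y v ord0 i by rewrite mxE [(- Y v) _ _]mxE.
  rewrite !subE -/(c 0 u) -/(c 0 v) -/(c 1 u) -/(c 1 v); lra.
Qed.

End surface_local_growth.

Section boundary_growth.
Context {R : realType}.
Local Notation H := (@hausdorff2 R).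

(** Upper Ahlfors regularity in dimension 2, with one constant for all centres, on or off the
    set. *)
Definition quadratic_growth (A : set 'rV[R]_3) : Prop :=
  exists2 C : R, 0 <= C & forall x r, 0 < r -> (H (A `&` eball x r) <= (C * r ^+ 2)%:E)%E.

Lemma quadratic_growthS A B : A `<=` B -> quadratic_growth B -> quadratic_growth A.
Proof.
move=> AB [C C0 BC]; exists C => // x r r0; apply: le_trans (BC x r r0).
by apply: le_hausdorff2; exact: setSI.
Qed.

Lemma quadratic_growth0 : quadratic_growth set0.
Proof.
by exists 0 => // x r r0; rewrite set0I hausdorff20 mul0r.
Qed.

Lemma quadratic_growthU A B :
  quadratic_growth A -> quadratic_growth B -> quadratic_growth (A `|` B).
Proof.
move=> [C C0 AC] [C' C'0 BC]; exists (C + C'); first by rewrite addr_ge0.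
move=> x r r0; rewrite setIUl; apply: (le_trans (outer_measureU2 (hausdorff2_outer R) _ _)).
by rewrite mulrDl EFinD; apply: leeD; [exact: AC|exact: BC].
Qed.

Lemma quadratic_growth_bigcup (I : eqType) (l : seq I) (F : I -> set 'rV[R]_3) :
  (forall i, i \in l -> quadratic_growth (F i)) ->
  quadratic_growth (\bigcup_(i in [set` l]) F i).
Proof.
elim: l => [|i l IH] Fl.
  apply: quadratic_growthS quadratic_growth0 => x [j /=].
  by rewrite in_nil.
apply: (@quadratic_growthS _ (F i `|` \bigcup_(i in [set` l]) F i)).
  move=> x [j /=]; rewrite inE => /predU1P[->|jl] Fx; first by left.
  by right; exists j.
apply: quadratic_growthU; first by apply: Fl; rewrite mem_head.
by apply: IH => j jl; apply: Fl; rewrite in_cons jl orbT.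
Qed.

Lemma open_eball n (p : 'rV[R]_n) r : open (eball p r).
Proof.
rewrite (_ : eball p r = (fun y => enorm (y - p)) @^-1` [set x | x < r])//.
apply: open_comp; first by move=> y _; exact: continuous_enorm_sub.
exact: open_lt.
Qed.

(** Finitely many balls from [C1_holder_local_growth] cover [S], and finite unions preserve the
    bound. *)
Lemma compact_quadratic_growth (s : R) (S : set 'rV[R]_3) : 0 < s -> compact S ->
  C1_holder_surface s S -> quadratic_growth S.
Proof.
move=> s0 cS SC.
have /choice[rad radP] : forall p, exists rad : R, S p -> 0 < rad /\
    quadratic_growth (S `&` eball p rad).
  move=> p; have [Sp|nSp] := pselect (S p); last by exists 1.
  have [rad [C [rad0 C0 h]]] := C1_holder_local_growth s0 SC Sp.
  by exists rad => _; split => //; exists C.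
move: cS; rewrite compact_cover => /(_ _ S (fun p => eball p (rad p))).
have op p : S p -> open (eball p (rad p)) by move=> _; exact: open_eball.
move=> /(_ op)[|D' D'S cov].
  move=> p Sp; exists p => //.
  by rewrite /eball /= subrr enorm0; have [] := radP p Sp.
have sub : S `<=` \bigcup_(p in [set` enum_fset D']) (S `&` eball p (rad p)).
  by move=> x Sx; have [p pD' xp] := cov x Sx; exists p.
apply: (quadratic_growthS sub); apply: quadratic_growth_bigcup => p pD'.
by have [] := radP p (set_mem (D'S p pD')).
Qed.

End boundary_growth.

(** * The boundary of the resonators: decomposition, growth, measurability and finite area *)

Section resonator_boundary.
Context {R : realType} {N : nat} {s : R} {D : 'I_N -> set 'rV[R]_3}.
Hypotheses (s0 : 0 < s) (hD : resonators s D).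
Let bD := boundary (\bigcup_n D n).

(** Closure commutes with finite unions, and disjointness of the closures keeps a boundary point of
    one resonator out of all the others. *)
Lemma boundary_resonators : boundary (\bigcup_n D n) = \bigcup_n boundary (D n).
Proof.
have [oD disj _] := hD.
have op n : open (D n) by have [] := oD n.
have clU : closure (\bigcup_n D n) = \bigcup_n closure (D n).
  apply/seteqP; split; last first.
    by move=> x [n _]; apply: closure_subset => y Dy; exists n.
  have cl : closed (\bigcup_n closure (D n)).
    by apply: closed_bigcup => [|n _]; [exact: finite_finset|exact: closed_closure].
  rewrite [X in _ `<=` X](closure_id _).1//; apply: closure_subset => x [n _ Dx].
  by exists n => //; exact: subset_closure.
rewrite /boundary clU.
have oU : open (\bigcup_n D n) by apply: bigcup_open => n _.
rewrite [(\bigcup_n D n)^°](interior_id _).1//.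
apply/seteqP; split => x.
  move=> [[n _ cx] nx]; exists n => //; split => //.
  rewrite [(D n)^°](interior_id _).1// => Dx; apply: nx; by exists n.
move=> [n _ [cx]]; rewrite [(D n)^°](interior_id _).1// => nx; split; first by exists n.
move=> [m _ Dx]; have [mn|mn] := eqVneq m n; first by rewrite mn in Dx.
have : (closure (D m) `&` closure (D n)) x by split => //; exact: subset_closure.
by rewrite disj.
Qed.

Lemma boundary_resonators_disjoint m n : m != n ->
  boundary (D m) `&` boundary (D n) = set0.
Proof.
have [_ disj _] := hD => mn; rewrite -subset0 -(disj m n mn) => x [[mx _] [nx _]].
by split.
Qed.

Lemma compact_boundary n : compact (boundary (D n) : set 'rV[R]_3).
Proof.
have [oD _ _] := hD; have [_ bdD _] := oD n.
apply: bounded_closed_compact; last first.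
  rewrite /boundary setDE; apply: closedI; first exact: closed_closure.
  by apply: open_closedC; exact: open_interior.
have [M [Mr MD]] := bdD; exists M; split => // x Mx y [cy _] /=.
have cl : closed [set z : 'rV[R]_3 | `|z| <= x].
  rewrite (_ : [set z | _] = (fun z : 'rV[R]_3 => `|z|) @^-1` [set t : R | t <= x])//.
  by apply: closed_comp; [move=> z _; exact: norm_continuous|exact: closed_le].
have sub : D n `<=` [set z : 'rV[R]_3 | `|z| <= x] by move=> z Dz; exact: MD.
by have := closure_subset sub cy; rewrite -(closure_id _).1.
Qed.

Lemma quadratic_growth_boundary : quadratic_growth (bD : set 'rV[R]_3).
Proof.
rewrite /bD boundary_resonators; have [_ _ SC] := hD.
apply: (@quadratic_growthS _ _ (\bigcup_(n in [set` enum 'I_N]) boundary (D n))).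
  by move=> x [n _ bx]; exists n => //=; rewrite mem_enum.
apply: quadratic_growth_bigcup => n _.
exact: (compact_quadratic_growth s0 (@compact_boundary n) (SC n)).
Qed.

Lemma measurable_boundary n : measurable (boundary (D n)).
Proof.
by apply: measurable_closed; apply: compact_closed => //; exact: compact_boundary.
Qed.

Lemma measurable_boundary_resonators : measurable bD.
Proof.
rewrite /bD boundary_resonators; apply: fin_bigcup_measurable => //.
by move=> n _; exact: measurable_boundary.
Qed.

Lemma boundary_sub_eball : exists2 r : R, 0 < r & (bD : set 'rV[R]_3) `<=` eball 0 r.
Proof.
have /choice[r rP] : forall n, exists r : R, 0 < r /\ boundary (D n) `<=` eball 0 r.
  move=> n; have [M [Mr MD]] := compact_bounded (@compact_boundary n).
  pose m := `|M| + 1.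
  (* The factor 3 passes from the sup norm to the Euclidean norm. *)
  exists (3 * (m + 1) + 1); split.
    have : 0 < m by rewrite /m ltr_wpDl.
    lra.
  move=> x bx; rewrite /eball /= subr0.
  have xm : `|x| <= m by apply: MD => //; rewrite /m (le_lt_trans (ler_norm _))// ltrDl.
  have : ball 0 (m + 1) x.
    by rewrite mx_norm_ball /ball_ /= sub0r normrN (le_lt_trans xm)// ltrDl.
  by move=> /ball_enorm_le; rewrite sub0r enormN; lra.
have r0 n : 0 <= r n by apply/ltW; have [] := rP n.
exists (\sum_n r n + 1); first by rewrite ltr_wpDl// sumr_ge0.
rewrite /bD boundary_resonators => x [n _ bx].
have [_ /(_ x bx)] := rP n; rewrite /eball /= => h; apply: (lt_trans h).
by rewrite (bigD1 n)//= -addrA ltrDl ltr_wpDl// sumr_ge0.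
Qed.

Lemma sigma_boundary_lty : (sigma R bD < +oo)%E.
Proof.
have [r r0 br] := boundary_sub_eball.
have [C C0 /(_ 0 r r0) h] := quadratic_growth_boundary.
rewrite -(setIidl br); exact: le_lt_trans h (ltry _).
Qed.

End resonator_boundary.

(** * Newtonian potentials of surface densities *)

Section newton_kernel.
Context {R : realType}.
Local Notation R3 := (R3 R).
Local Notation sigma := (sigma R).

Definition newton (x y : 'rV[R]_3) : R := (enorm (x - y))^-1.

Lemma newton_ge0 x y : 0 <= newton x y.
Proof. by rewrite invr_ge0 enorm_ge0. Qed.

Lemma newtonC x y : newton x y = newton y x.
Proof. by rewrite /newton enormC. Qed.

Lemma newton_powR x y : newton x y = enorm (x - y) `^ (-1).
Proof. by rewrite powR_inv1 ?enorm_ge0. Qed.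

Lemma measurable_newton x : measurable_fun setT (newton x : R3 -> R).
Proof.
rewrite (_ : newton x = (fun u : R => u `^ (-1)) \o (fun y => enorm (y - x))).
  apply: measurableT_comp; first exact: measurable_powR.
  by apply: continuous_measurable_R3; exact: continuous_enorm_sub.
by apply/funext => y; rewrite newton_powR enormC.
Qed.

(** Tonelli's theorem asks for measurability in the product sigma-algebra, so the kernel is
    rewritten through the coordinates of the two factors. *)
Lemma measurable_newton2 :
  measurable_fun setT (fun xy : R3 * R3 => newton xy.1 xy.2).
Proof.
rewrite (_ : (fun xy => _) = (fun u : R => u `^ (-1)) \o (@Num.sqrt R) \o
    (fun xy : R3 * R3 => \sum_(i < 3) (xy.1 ord0 i - xy.2 ord0 i) ^+ 2)); last first.
  apply/funext => -[x y]; rewrite newton_powR /enorm /=; congr (Num.sqrt _ `^ _).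
  by apply: eq_bigr => i _; rewrite !mxE.
apply: measurableT_comp; first apply: measurableT_comp.
- exact: measurable_powR.
- by apply: continuous_measurable_fun; exact: sqrt_continuous.
apply: measurable_sum => i; apply: measurable_funX.
have mc : measurable_fun setT (fun y : R3 => (y : 'rV[R]_3) ord0 i).
  by apply: continuous_measurable_R3; exact: coord_continuous.
apply: measurable_funB.
  exact: (measurableT_comp mc measurable_fst).
exact: (measurableT_comp mc measurable_snd).
Qed.

Context (B : set R3) (mB : measurable B) (Boo : (sigma B < +oo)%E)
  (gB : quadratic_growth (B : set 'rV[R]_3)).

Lemma measurable_eball (x : 'rV[R]_3) r : measurable (eball x r : set R3).
Proof. by apply: measurable_open; exact: open_eball. Qed.

(** The growth bound for balls around [x] whose radius tends to 0. *)
Lemma sigma_point (x : 'rV[R]_3) : sigma (B `&` [set x]) = 0%E.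
Proof.
have [C C0 h] := gB.
apply/eqP; rewrite eq_le measure_ge0 andbT.
apply/lee_addgt0Pr => e e0; rewrite add0e.
have C1 : 0 < C + 1 by rewrite ltr_wpDl.
pose r := Num.sqrt (e / (C + 1)).
have r0 : 0 < r by rewrite sqrtr_gt0 divr_gt0.
apply: (@le_trans _ _ (C * r ^+ 2)%:E).
  apply: le_trans (h x r r0); apply: le_hausdorff2 => y [By yx]; split => //.
  by rewrite yx /eball /= subrr enorm0.
rewrite lee_fin sqr_sqrtr ?divr_ge0 ?(ltW e0) ?(ltW C1)// mulrA ler_pdivrMr//.
by rewrite mulrC ler_pM2l// lerDl.
Qed.

(** For [2^-(n+1) <= |x - y| < 2^-n] the [n]-th term alone dominates the kernel; from distance 1 on
    the constant 1 does, and on the diagonal the kernel is 0, the inverse of 0. *)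
Lemma newton_le_dyadic (x y : R3) :
  ((newton x y)%:E <= 1 + \sum_(n <oo) (2 ^+ n.+1 * \1_(eball x (2 ^- n) : set R3) y)%:E)%E.
Proof.
have S0 n : (0 <= (2 ^+ n.+1 * \1_(eball x (2 ^- n) : set R3) y)%:E :> \bar R)%E.
  by rewrite lee_fin mulr_ge0// exprn_ge0.
have [xy|xy] := leP 1 (enorm (x - y)).
  apply: (@le_trans _ _ 1%E); last by rewrite leeDl// nneseries_ge0.
  by rewrite lee_fin invf_le1// (lt_le_trans ltr01).
have [e0|e0] := eqVneq (enorm (x - y)) 0.
  by rewrite /newton e0 invr0 adde_ge0// nneseries_ge0.
have ep : 0 < enorm (x - y) by rewrite lt_neqAle eq_sym e0 enorm_ge0.
have [n] : exists n, 2 ^- n.+1 <= enorm (x - y) < 2 ^- n.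
  have ex : exists m, 2 ^- m <= enorm (x - y).
    exists (Num.truncn (enorm (x - y))^-1).+1.
    rewrite invf_ple ?posrE// ?exprn_gt0//; apply: (le_trans (ltW (truncnS_gt _))).
    by rewrite -natrX ler_nat; apply/ltnW/ltn_expl.
  case: (ex_minnP ex) => -[|n] hn minn.
    by move: hn; rewrite expr0 invr1 leNgt xy.
  exists n; rewrite hn ltNge; apply/negP => /minn; by rewrite ltnn.
move=> /andP[n1 n2].
rewrite (nneseriesD1 (n := n))//.
apply: (@le_trans _ _ (2 ^+ n.+1 * \1_(eball x (2 ^- n) : set R3) y)%:E).
  rewrite indicE mem_set ?mulr1 ?lee_fin.
    by rewrite /newton invf_ple ?posrE// ?exprn_gt0.
  by rewrite /eball /= enormC.
by rewrite addeCA leeDl// adde_ge0// nneseries_ge0.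
Qed.

(** By quadratic growth the [n]-th dyadic term contributes at most [2^(n+1) C 4^-n]; these sum to
    [4 C], whatever [x] is. *)
Lemma integral_newton_le : exists2 K : R, 0 <= K &
  forall x, (\int[sigma]_(y in B) (newton x y)%:E <= K%:E)%E.
Proof.
have [C C0 h] := gB.
exists (fine (sigma B) + C * 4).
  by rewrite addr_ge0 ?fine_ge0 ?mulr_ge0// measure_ge0.
move=> x; pose F n (y : R3) : \bar R := (2 ^+ n.+1 * \1_(eball x (2 ^- n) : set R3) y)%:E.
have mF n : measurable_fun B (F n).
  apply/measurable_EFinP; apply: measurable_funM; first exact: measurable_cst.
  by apply: measurable_indic; exact: measurable_eball.
have F0 n y : (0 <= F n y)%E by rewrite lee_fin mulr_ge0// exprn_ge0.
pose S (y : R3) : \bar R := (\sum_(n <oo) F n y)%E.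
have S0 y : B y -> (0 <= S y)%E by move=> _; exact: nneseries_ge0.
have mS : measurable_fun B S.
  by apply: ge0_emeasurable_sum => n y *; [exact: F0|exact: mF].
have mB1 : measurable_fun B (cst (1%E : \bar R)) by exact: measurable_cst.
have B10 y : B y -> (0 <= cst (1%E : \bar R) y)%E by [].
apply: (@le_trans _ _ (\int[sigma]_(y in B) (cst 1 y + S y))%E).
  apply: (ge0_le_integral _ mB).
  - by move=> y _; rewrite lee_fin newton_ge0.
  - by apply/measurable_EFinP; apply: measurable_funTS; exact: measurable_newton.
  - exact: emeasurable_funD.
  - by move=> y _; exact: newton_le_dyadic.
rewrite (ge0_integralD _ mB B10 mB1 S0 mS) (integral_cst _ mB) mul1e EFinD; apply: leeD.
  by rewrite fineK// ge0_fin_numE// measure_ge0.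
rewrite /S (integral_nneseries _ mB mF); last by move=> n y _; exact: F0.
have Fn n : (\int[sigma]_(y in B) F n y <= (C * (2 * 2 ^- n))%:E)%E.
  have p : 0 < 2 ^- n :> R by rewrite invr_gt0 exprn_gt0.
  rewrite (_ : integral _ _ _ = (2 ^+ n.+1)%:E * sigma (eball x (2 ^- n) `&` B))%E.
    apply: (@le_trans _ _ ((2 ^+ n.+1)%:E * (C * (2 ^- n) ^+ 2)%:E)%E).
      apply: lee_wpmul2l; first by rewrite lee_fin exprn_ge0.
      by rewrite setIC; exact: h.
    rewrite -EFinM lee_fin mulrCA ler_wpM2l// exprS -mulrA ler_wpM2l//.
    by rewrite expr2 mulrA divff ?mul1r// expf_neq0.
  have mI : measurable_fun B (fun y : R3 => (\1_(eball x (2 ^- n) : set R3) y : R)%:E).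
    by apply/measurable_EFinP; apply: measurable_indic; exact: measurable_eball.
  rewrite -(integral_indic _ mB (measurable_eball x _)).
  by rewrite -(ge0_integralZl _ mB mI)// lee_fin exprn_ge0.
apply: lime_le; first by apply: is_cvg_nneseries => n _ _; exact: integral_ge0.
apply: nearW => m; apply: (@le_trans _ _ (\sum_(0 <= n < m) (C * (2 * 2 ^- n))%:E)%E).
  by apply: lee_sum => n _; exact: Fn.
rewrite sumEFin lee_fin -mulr_sumr ler_wpM2l//.
have -> : \sum_(0 <= n < m) 2 * 2 ^- n = 4 - 4 * 2 ^- m :> R.
  elim: m => [|m IH]; first by rewrite big_geq// expr0; lra.
  rewrite big_nat_recr//= IH exprS invfM; lra.
by rewrite gerBl mulr_ge0// invr_ge0 exprn_ge0.
Qed.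

End newton_kernel.

(** * Almost everywhere finiteness of Newtonian potentials *)

Section newton_potential.
Context {R : realType}.
Local Notation R3 := (R3 R).
Local Notation sigma := (sigma R).
Context (B : set R3) (mB : measurable B) (Boo : (sigma B < +oo)%E)
  (gB : quadratic_growth (B : set 'rV[R]_3)).

(** The restriction of [sigma] to [B], made a finite measure so that Tonelli's theorem applies. *)
Let mu : {finite_measure set R3 -> \bar R} := mfrestr mB Boo.

Let integral_mu (h : R3 -> \bar R) : (forall x, 0 <= h x)%E -> measurable_fun setT h ->
  (\int[mu]_x h x = \int[sigma]_(x in B) h x)%E.
Proof.
move=> h0 mh; have mBc : measurable (~` B) by exact: measurableC.
have muBc : mu (~` B) = 0%E.
  by change (sigma (~` B `&` B) = 0%E); rewrite setICl; exact: measure0.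
have dis : [disjoint B & ~` B] by exact/disj_setPCl.
have mhU : measurable_fun (B `|` ~` B) h by rewrite setUv.
rewrite -(setUv B) (ge0_integral_setU _ mB mBc mhU (fun x _ => h0 x) dis).
rewrite (null_set_integral mBc (measurable_funTS mh) muBc) adde0.
apply: eq_measure_integral => A mA AB.
by change (sigma (A `&` B) = sigma A); rewrite setIidl.
Qed.

(** By Tonelli and the symmetry of the kernel, the potential of [|f|] has integral at most [K] times
    that of [|f|]; hence it is finite almost everywhere. *)
Lemma ae_integrable_newton (f : R3 -> R) : sigma.-integrable B (EFin \o f) ->
  {ae sigma, forall x, B x -> sigma.-integrable B (fun y => (newton x y * f y)%:E)}.
Proof.
move=> /integrableP[mf foo].
have {}mf : measurable_fun B f by apply/measurable_EFinP.
pose g := f \_ B.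
have mg : measurable_fun setT g by apply/(measurable_restrictT _ mB).
pose F (xy : R3 * R3) : \bar R := (newton xy.1 xy.2 * `|g xy.2|)%:E.
have F0 xy : (0 <= F xy)%E by rewrite lee_fin mulr_ge0// newton_ge0.
have mF : measurable_fun setT F.
  apply/measurable_EFinP; apply: measurable_funM; first exact: measurable_newton2.
  apply: measurableT_comp; first exact: normr_measurable.
  exact: (measurableT_comp mg measurable_snd).
have mF1 x : measurable_fun setT (fun y => F (x, y)).
  apply/measurable_EFinP; apply: measurable_funM; first exact: measurable_newton.
  by apply: measurableT_comp.
have mF2 y : measurable_fun setT (fun x => F (x, y)).
  have -> : (fun x => F (x, y)) = EFin \o (fun x : R3 => newton y x * `|g y|).
    by apply/funext => x; rewrite /F /= newtonC.
  apply/measurable_EFinP/measurable_funM; first exact: measurable_newton.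
  exact: measurable_cst.
have [K K0 hK] := integral_newton_le mB Boo gB.
pose H x := (\int[mu]_y F (x, y))%E.
have mH : measurable_fun setT H.
  exact: (measurable_fun_fubini_tonelli_F (m2 := mu) F mF F0).
have H0 x : (0 <= H x)%E by exact: integral_ge0.
have HE x : H x = (\int[sigma]_(y in B) (newton x y * `|f y|)%:E)%E.
  rewrite /H integral_mu//; apply: eq_integral => y yB.
  by rewrite /F /= /g patchE yB.
have Hoo : (\int[sigma]_(x in B) H x < +oo)%E.
  rewrite -(integral_mu H0 mH) /H (fubini_tonelli (m1 := mu) (m2 := mu) _ mF F0).
  pose k (y : R3) : \bar R := (K * `|g y|)%:E.
  have mk : measurable_fun setT k.
    apply/measurable_EFinP/measurable_funM; first exact: measurable_cst.
    exact: (measurableT_comp _ mg).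
  have k0 y : (0 <= k y)%E by rewrite lee_fin mulr_ge0.
  apply: (@le_lt_trans _ _ (\int[mu]_y k y)%E).
    apply: (ge0_le_integral _ measurableT).
    - by move=> y _; exact: integral_ge0.
    - exact: (measurable_fun_fubini_tonelli_G (m1 := mu) F mF F0).
    - exact: mk.
    - move=> y _.
      have -> : (\int[mu]_x F (x, y) = `|g y|%:E * \int[sigma]_(x in B) (newton y x)%:E)%E.
        rewrite (integral_mu (fun x => F0 (x, y)) (mF2 y)).
        rewrite -(ge0_integralZl _ mB).
        + by apply: eq_integral => x _; rewrite /F /= -EFinM mulrC newtonC.
        + by apply/measurable_EFinP; apply: measurable_funTS; exact: measurable_newton.
        + by move=> x _; rewrite lee_fin newton_ge0.
        + by rewrite lee_fin.
      by rewrite /k mulrC EFinM; apply: lee_wpmul2l; [rewrite lee_fin|exact: hK].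
  rewrite (integral_mu k0 mk).
  have mf' : measurable_fun B (fun y => `|(EFin \o f) y|%E).
    by apply/measurable_EFinP; exact: (measurableT_comp _ mf).
  rewrite (_ : integral _ _ _ = K%:E * \int[sigma]_(y in B) `|(EFin \o f) y|)%E.
    by apply: lte_mul_pinfty; rewrite ?lee_fin.
  rewrite -(ge0_integralZl _ mB mf')//.
  by apply: eq_integral => y yB; rewrite /k /g patchE yB /= EFinM.
have iH : sigma.-integrable B H.
  apply/integrableP; split; first exact: measurable_funTS.
  by under eq_integral do rewrite gee0_abs//.
apply: filterS (integrable_ae mB iH) => x + Bx => /(_ Bx).
rewrite ge0_fin_numE// HE => fin; apply/integrableP; split.
  apply/measurable_EFinP; apply: measurable_funM => //.
  by apply: measurable_funTS; exact: measurable_newton.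
apply: le_lt_trans fin.
by under eq_integral do rewrite abse_EFin normrM (ger0_norm (newton_ge0 _ _)).
Qed.

End newton_potential.

(** * Charge of the sublevel sets of a potential *)

Section cells.
Context {R : realType}.
Local Notation R3 := (R3 R).
Local Notation sigma := (sigma R).
Implicit Types z : lattice.

Definition lvec z : 'rV[R]_3 :=
  \row_i [:: z.1.1%:~R; z.1.2%:~R; z.2%:~R]`_i.

Lemma lvecB z w : lvec (z - w) = lvec z - lvec w.
Proof.
apply/rowP => i; rewrite !mxE.
by case: i => [[|[|[|//]]]] _ /=; rewrite intrB.
Qed.

Lemma lnorm_lvec z : lnorm z = enorm (lvec z) :> R.
Proof.
rewrite /lnorm /enorm; congr Num.sqrt.
by rewrite !big_ord_recr big_ord0 /= add0r !mxE.
Qed.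

Definition cell (m : R) (x : 'rV[R]_3) : lattice :=
  (Num.floor (m * x ord0 0), Num.floor (m * x ord0 1), Num.floor (m * x ord0 (inord 2))).

Lemma lvec_cell m x : enorm (lvec (cell m x) - m *: x) <= 3.
Proof.
apply: (le_trans (enorm_le_sum _)).
apply: (@le_trans _ _ (\sum_(i < 3) 1)); last by rewrite sumr_const card_ord.
apply: ler_sum => i _.
have fl (t : R) : `|(Num.floor t)%:~R - t| <= 1.
  have := floor_le t; have := floorD1_gt t; rewrite intrD => h1 h2.
  rewrite ler_norml; apply/andP; split; lra.
rewrite !mxE; case: i => [[|[|[|//]]]] j /=.
- by rewrite (_ : Ordinal j = 0) ?fl//; apply: val_inj.
- by rewrite (_ : Ordinal j = 1) ?fl//; apply: val_inj.
- by rewrite (_ : Ordinal j = inord 2) ?fl//; apply: val_inj; rewrite /= inordK.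
Qed.

Lemma lnorm_cellB m x y : 0 <= m ->
  `|lnorm (cell m x - cell m y) - m * enorm (x - y)| <= 6.
Proof.
move=> m0; rewrite lnorm_lvec lvecB -[m in m * _]ger0_norm// -enormZ.
apply: (le_trans (ler_enorm_sub _ _)).
rewrite (_ : _ - _ - _ = (lvec (cell m x) - m *: x) - (lvec (cell m y) - m *: y)).
  apply: (le_trans (enormD _ _)); rewrite enormN.
  have := lvec_cell m x; have := lvec_cell m y; lra.
by rewrite scalerBr; move: (lvec _) (lvec _) => a b; apply/rowP => i; rewrite !mxE; ring.
Qed.

(** The lattice is countable and each fibre of [cell m] is cut out by three half-open conditions on
    coordinates, so [phi] may be arbitrary. *)
Lemma measurable_cell m (phi : lattice -> R) :
  measurable_fun setT (fun x : R3 => phi (cell m x)).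
Proof.
have mc z : measurable (cell m @^-1` [set z] : set R3).
  have mi i (k : int) : measurable [set x : R3 | Num.floor (m * (x : 'rV[R]_3) ord0 i) = k].
    rewrite (_ : mkset _ = (fun x : R3 => m * (x : 'rV[R]_3) ord0 i) @^-1` `[k%:~R, (k + 1)%:~R[%classic).
      rewrite -[X in measurable X]setTI.
      have mf : measurable_fun setT (fun x : R3 => m * (x : 'rV[R]_3) ord0 i).
        apply: measurable_funM; first exact: measurable_cst.
        by apply: continuous_measurable_R3; exact: coord_continuous.
      by apply: mf => //; exact: measurable_itv.
    apply/seteqP; split => x /=; rewrite in_itv/=.
      by move=> <-; rewrite floor_le floorD1_gt.
    by move=> h; apply: floor_def.
  case: z => [[a b] c].
  rewrite (_ : _ @^-1` _ = [set x : R3 | Num.floor (m * (x : 'rV[R]_3) ord0 0) = a] `&`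
    [set x : R3 | Num.floor (m * (x : 'rV[R]_3) ord0 1) = b] `&`
    [set x : R3 | Num.floor (m * (x : 'rV[R]_3) ord0 (inord 2)) = c]).
    by apply: measurableI; [apply: measurableI|]; exact: mi.
  by apply/seteqP; split => x /=; [case=> -> -> ->|move=> [[<- <-] <-]].
move=> _ Y mY; rewrite setTI.
pose unp (n : nat) : option lattice := @choice.unpickle (int * int * int)%type n.
have unpK (z : lattice) : exists n, unp n = Some z.
  by eexists; exact: choice.pickleK.
pose F n : set R3 := if unp n is Some z then
  (if `[< Y (phi z) >] then cell m @^-1` [set z] else set0) else set0.
rewrite (_ : _ @^-1` Y = \bigcup_n F n).
  by apply: bigcupT_measurable => n; rewrite /F; case: (unp n) => [z|//]; case: ifP.
apply/seteqP; split => x /=.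
  move=> Yx; have [n un] := unpK (cell m x).
  by exists n; [exact: Logic.I|rewrite /F un asboolT].
by move=> [n _]; rewrite /F; case: (unp n) => [z|//]; case: asboolP => // Yz /= ->.
Qed.

End cells.

Lemma integrable_bounded_mul d (T : measurableType d) (R : realType)
    (mu : {measure set T -> \bar R}) (B : set T) (mB : measurable B)
    (h f : T -> R) (M : R) :
  measurable_fun B h -> (forall y, `|h y| <= M) -> mu.-integrable B (EFin \o f) ->
  mu.-integrable B (fun y => (h y * f y)%:E).
Proof.
move=> mh hM fi; have mf : measurable_fun B f.
  by apply/measurable_EFinP; exact: measurable_int fi.
have i2 : mu.-integrable B (fun y => (M%:E * (EFin \o f) y)%E) by exact: integrableZl.
apply: le_integrable i2 => //.
  by apply/measurable_EFinP/measurable_funM.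
move=> y _; rewrite /= lee_fin !normrM ler_wpM2r//.
exact: le_trans (hM y) (ler_norm _).
Qed.

Lemma Rintegral_sum d (T : measurableType d) (R : realType)
    (mu : {measure set T -> \bar R}) (B : set T) (mB : measurable B)
    (I : Type) (s : seq I) (h : I -> T -> R) :
  (forall i, mu.-integrable B (EFin \o h i)) ->
  mu.-integrable B (fun y => (\sum_(i <- s) h i y)%:E) /\
  \int[mu]_(y in B) (\sum_(i <- s) h i y) = \sum_(i <- s) \int[mu]_(y in B) h i y.
Proof.
move=> hi; elim: s => [|i s [IH1 IH2]].
  have e y : \sum_(i <- [::]) h i y = 0 by rewrite big_nil.
  under [fun y => _]eq_fun do rewrite e.
  split; first exact: integrable0.
  under eq_Rintegral do rewrite e.
  by rewrite big_nil /Rintegral integral0_eq.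
have e y : \sum_(j <- i :: s) h j y = h i y + \sum_(j <- s) h j y by rewrite big_cons.
under [fun y => _]eq_fun do rewrite e EFinD.
split; first exact: (integrableD mB (hi i) IH1).
under eq_Rintegral do rewrite e.
by rewrite (RintegralD mB (hi i) IH1) IH2 big_cons.
Qed.

(** * Sign of the charge of a lattice sublevel set *)

Section discrete_sign.
Context {R : realType}.
Local Notation R3 := (R3 R).
Local Notation sigma := (sigma R).
Local Notation green := (@green R).
Context (B : set R3) (mB : measurable B) (f : R3 -> R).
Hypothesis fi : sigma.-integrable B (EFin \o f).

(** The potential [G * mu] for [mu] the image under [cell m] of the charge [f sigma], written as an
    integral over [B]. *)
Definition cell_potential (m : R) (z : lattice) : R :=
  \int[sigma]_(y in B) (green (z - cell m y) * f y).

Let green_bounded (z : lattice) : `|green z| <= 2.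
Proof. by rewrite ger0_norm ?green_ge0 ?green_le2. Qed.

Lemma integrable_cell_green m z :
  sigma.-integrable B (fun y => (green (z - cell m y) * f y)%:E).
Proof.
apply: (integrable_bounded_mul mB (M := 2) _ _ fi).
  by apply: measurable_funTS; exact: (measurable_cell m (fun w => green (z - w))).
by move=> y; exact: green_bounded.
Qed.

(** [green_laverage] integrated against [f]; the right side is the charge rounded to [z]. *)
Lemma cell_potential_laverage m z :
  cell_potential m z - laverage (cell_potential m) z =
  \int[sigma]_(y in B) ((cell m y == z)%:R * f y).
Proof.
rewrite /laverage.
under eq_bigr do rewrite /cell_potential -(RintegralZl _ mB (integrable_cell_green _ _)).
have hi e : sigma.-integrable B
    (EFin \o (fun y => weight e * (green (z + lstep e - cell m y) * f y))).
  exact: (integrableZl mB (weight e) (integrable_cell_green m (z + lstep e))).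
have [i1 <-] := Rintegral_sum mB (index_enum _) hi.
rewrite /cell_potential -(RintegralB mB (integrable_cell_green m z) i1).
apply: eq_Rintegral => y _.
have -> : (cell m y == z)%:R = green (z - cell m y) - laverage green (z - cell m y).
  by rewrite green_laverage subr_eq0 eq_sym.
rewrite mulrBl /laverage mulr_suml; congr (_ - _); apply: eq_bigr => e _.
by rewrite mulrA [z + _ - _]addrAC.
Qed.

Lemma cell_potential_sublevel_finite m (r l : R) : 0 <= m -> B `<=` eball (0 : 'rV[R]_3) r ->
  l < 0 -> finite_set [set z | cell_potential m z <= l].
Proof.
move=> m0 Br l0.
pose F := \int[sigma]_(y in B) `|f y|.
have F0 : 0 <= F by exact: Rintegral_ge0.
(* [M] bounds the norm of the rounded points of [B]. At distance more than [A] from all of them,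
   [green_le] makes the potential at most [16 / A * F < - l] in absolute value. *)
pose M := m * r + 3; pose A := 16 * F / - l + 1.
apply: (@sub_finite_set _ _ [set z : lattice | lnorm z <= M + A]); last exact: finite_lnorm.
move=> z /= Uz; rewrite leNgt; apply/negP => zMA.
have A0 : 0 < A by rewrite /A ltr_wpDl// divr_ge0 ?mulr_ge0// oppr_ge0 ltW.
have gA y : B y -> green (z - cell m y) <= 16 / A.
  move=> By; rewrite ler_pdivlMr// mulrC.
  apply: le_trans (green_le (z - cell m y)); rewrite ler_wpM2r ?green_ge0//.
  rewrite lnorm_lvec lvecB; rewrite lnorm_lvec in zMA.
  have yr : enorm (lvec (cell m y)) <= M.
    have := lvec_cell m y; have := enormD (lvec (cell m y) - m *: y) (m *: y).
    rewrite subrK enormZ ger0_norm// => h1 h2.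
    have : m * enorm y <= m * r.
      by rewrite ler_wpM2l//; have := Br y By; rewrite /eball /= subr0 => /ltW.
    rewrite /M; lra.
  have : enorm (@lvec R z) <= enorm (@lvec R z - lvec (cell m y)) + enorm (@lvec R (cell m y)).
    by apply: le_trans (enormD _ _); rewrite subrK.
  lra.
have : `|cell_potential m z| <= 16 / A * F.
  apply: (le_trans (le_normr_Rintegral mB (integrable_cell_green m z))).
  have nfi := integrable_norm fi.
  rewrite -(RintegralZl _ mB nfi).
  apply: (le_Rintegral mB (integrable_norm (integrable_cell_green m z))
    (integrableZl mB (16 / A) nfi)).
  move=> y By; rewrite /= normrM (ger0_norm (green_ge0 _)) ler_wpM2r//; exact: gA.
have : 16 / A * F < - l.
  rewrite mulrAC ltr_pdivrMr// /A mulrDr mulr1 mulrCA mulfV; last by rewrite oppr_eq0 lt_eqF.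
  by rewrite mulr1 ltrDl oppr_gt0.
rewrite ler_norml; lra.
Qed.

(** The sum of [cell_potential_laverage] over the finite sublevel set, whose sign is given by
    [sum_sublevel_laverage]. *)
Lemma sublevel_charge_le0 m (r l : R) : 0 <= m -> B `<=` eball (0 : 'rV[R]_3) r -> l < 0 ->
  \int[sigma]_(y in B) ((cell_potential m (cell m y) <= l)%R%:R * f y) <= 0.
Proof.
move=> m0 Br l0.
have /finite_seqP[s0 s0P] := cell_potential_sublevel_finite m0 Br l0.
pose s := undup s0.
have sP z : (z \in s) = (cell_potential m z <= l).
  rewrite mem_undup; apply/idP/idP => h; last by have : [set` s0] z by rewrite -s0P.
  by have : [set` s0] z by []; rewrite -s0P.
have := sum_sublevel_laverage (undup_uniq s0) sP.
under eq_bigr do rewrite cell_potential_laverage.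
have hi z : sigma.-integrable B (EFin \o (fun y => (cell m y == z)%:R * f y)).
  apply: (integrable_bounded_mul mB (M := 1) _ _ fi).
    by apply: measurable_funTS; exact: (measurable_cell m (fun w => (w == z)%:R)).
  by move=> y; case: eqP => _; rewrite ?normr1 ?normr0.
have [_ <-] := Rintegral_sum mB s hi.
apply: le_trans; rewrite le_eqVlt; apply/orP; left; apply/eqP.
apply: eq_Rintegral => y _; rewrite -mulr_suml; congr (_ * _).
rewrite -sP; have [ys|ys] := boolP (cell m y \in s).
  rewrite (bigD1_seq (cell m y))//= ?undup_uniq// eqxx big1 ?addr0// => z zn.
  by rewrite eq_sym (negbTE zn).
rewrite big_seq big1// => z zs.
by case: eqP => // e; rewrite e zs in ys.
Qed.

End discrete_sign.

(** * Convergence of the lattice potentials to the Newtonian potential *)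

Section discrete_limit.
Context {R : realType}.
Local Notation R3 := (R3 R).
Local Notation sigma := (sigma R).
Local Notation green := (@green R).
Local Notation lnorm := (@lnorm R).
Context (B : set R3) (mB : measurable B) (gB : quadratic_growth (B : set 'rV[R]_3)).

(** A majorant independent of [m]. If [m |x - y| >= 12], the rounding error 6 is at most half of it
    and [green_le] yields [2 * 16]; otherwise [green_le2] yields [12 * 2]. *)
Lemma green_cell_le (m : R) (x y : 'rV[R]_3) : 0 <= m -> x != y ->
  m * green (cell m x - cell m y) <= 32 * newton x y.
Proof.
move=> m0 xy; set z := _ - _.
have e0 : 0 < enorm (x - y).
  rewrite lt_neqAle enorm_ge0 andbT eq_sym; apply/eqP => /enorm_eq0/eqP.
  by rewrite subr_eq0 (negbTE xy).
rewrite /newton ler_pdivlMr//.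
have := lnorm_cellB x y m0; rewrite -/z ler_norml => /andP[h1 h2].
have := @green_le R z; have := @green_le2 R z; have := @green_ge0 R z.
set g := green z; set d := enorm (x - y) in e0 h1 h2 *.
move=> g0 g2 gl.
have md0 : 0 <= m * d by rewrite mulr_ge0// ltW.
have [d12|d12] := leP 12 (m * d).
  have : (m * d) * g <= 2 * lnorm z * g by rewrite ler_wpM2r//; lra.
  by rewrite -mulrA; nra.
have : (m * d) * g <= 12 * 2 by apply: ler_pM => //; exact: ltW.
by rewrite mulrAC; lra.
Qed.

Lemma green_cell_cvg : exists2 kappa : R, 0 < kappa & forall x y : 'rV[R]_3, x != y ->
  m%:R * green (cell m%:R x - cell m%:R y) @[m --> \oo] --> kappa * newton x y.
Proof.
have [kappa k0 kP] := @green_cvg R; exists kappa => // x y xy.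
have e0 : 0 < enorm (x - y).
  rewrite lt_neqAle enorm_ge0 andbT eq_sym; apply/eqP => /enorm_eq0/eqP.
  by rewrite subr_eq0 (negbTE xy).
set d := enorm (x - y) in e0 *.
pose z (m : nat) := cell m%:R x - cell m%:R y.
have zd m : `|lnorm (z m) - m%:R * d| <= 6 by apply: lnorm_cellB.
have zoo : lnorm (z m) @[m --> \oo] --> +oo.
  apply/cvgryPge => A.
  have : \forall m \near \oo, (A + 6) / d <= (m%:R : R) by exact: (cvgryPge _).1 cvgr_idn _.
  apply: filterS => m; rewrite ler_pdivrMr// => h.
  have := zd m; rewrite ler_norml => /andP[h1 _]; lra.
have rat : m%:R^-1 * lnorm (z m) @[m --> \oo] --> d.
  apply/cvgrPdist_le => e ep.
  have : \forall m \near \oo, 6 / e + 1 <= (m%:R : R) by exact: (cvgryPge _).1 cvgr_idn _.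
  apply: filterS => m hm.
  have m0 : 0 < m%:R :> R by apply: lt_le_trans hm; rewrite ltr_wpDl// divr_ge0// ltW.
  rewrite distrC -[d](mulKf (lt0r_neq0 m0)) -mulrBr normrM ger0_norm ?invr_ge0//.
  rewrite mulrC ler_pdivrMr//; apply: (le_trans (zd m)).
  by rewrite mulrC -ler_pdivrMr//; lra.
have h : (m%:R^-1 * lnorm (z m))^-1 * (lnorm (z m) * green (z m)) @[m --> \oo] --> d^-1 * kappa.
  by apply: cvgM; [apply: cvgV => //; exact: lt0r_neq0|exact: kP].
rewrite /newton -/d [kappa * _]mulrC; apply: cvg_trans h; apply: near_eq_cvg.
have : \forall m \near \oo, 1 <= lnorm (z m) by exact: (cvgryPge _).1 zoo 1.
apply: filterS => m zm; rewrite /= invfM invrK -/(z m) -mulrA mulKf// gt_eqF//.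
exact: lt_le_trans zm.
Qed.

Context (f : R3 -> R) (fi : sigma.-integrable B (EFin \o f)).

(** Dominated convergence with majorant [32 * newton x y * |f y|]. The bound and the pointwise limit
    concern [y != x], and the point [x] has measure 0. *)
Lemma cell_potential_cvg : exists2 kappa : R, 0 < kappa & forall x : R3,
  sigma.-integrable B (fun y => (newton x y * f y)%:E) ->
  m%:R * cell_potential B f m%:R (cell m%:R x) @[m --> \oo] -->
    kappa * \int[sigma]_(y in B) (newton x y * f y).
Proof.
have [kappa k0 kP] := green_cell_cvg; exists kappa => // x xi.
pose h (m : nat) (y : R3) : R := m%:R * (green (cell m%:R x - cell m%:R y) * f y).
have hi m : sigma.-integrable B (EFin \o h m).
  exact: (integrableZl mB _ (integrable_cell_green mB fi m%:R (cell m%:R x))).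
have ki : sigma.-integrable B (EFin \o (fun y => kappa * (newton x y * f y))).
  exact: (integrableZl mB _ xi).
pose G (y : R3) : R := 32 * `|newton x y * f y|.
have gi : sigma.-integrable B (EFin \o G).
  exact: (integrableZl mB _ (integrable_norm xi)).
have nx : {ae sigma, forall y, B y -> y != x}.
  exists (B `&` [set x]); split.
  - apply: measurableI => //; apply: measurable_closed.
    by apply: compact_closed => //; exact: compact_set1.
  - exact: sigma_point gB x.
  - by move=> y /not_implyP[By /negP]; rewrite negbK => /eqP.
have hcvg : {ae sigma, forall y, B y ->
    (EFin \o h m) y @[m --> \oo] --> (EFin \o (fun y => kappa * (newton x y * f y))) y}.
  apply: filterS nx => y yx By.
  suff c : h m y @[m --> \oo] --> kappa * (newton x y * f y).
    by apply: cvg_EFin; [exact: nearW|exact: c].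
  rewrite mulrA (_ : (fun m => h m y) = (fun m : nat =>
      (m%:R * green (cell m%:R x - cell m%:R y)) * f y)); last first.
    by apply/funext => m; rewrite /h mulrA.
  apply: cvgM; last exact: cvg_cst.
  by apply: kP; rewrite eq_sym yx.
have hdom : {ae sigma, forall y, forall m, B y -> (`|(EFin \o h m) y| <=
    (EFin \o G) y)%E}.
  apply: filterS nx => y yx m By; rewrite /= lee_fin /h /G mulrA normrM [X in X * _]ger0_norm.
    rewrite normrM (ger0_norm (newton_ge0 _ _)) mulrA ler_wpM2r//.
    by apply: green_cell_le => //; rewrite eq_sym yx.
  by rewrite mulr_ge0// green_ge0.
have [_ _ c] := dominated_convergence mB (fun m => measurable_int _ (hi m)) (measurable_int _ ki)
  hcvg gi hdom.
rewrite -(RintegralZl _ mB xi).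
rewrite (_ : (fun m => _) = (fun m => \int[sigma]_(y in B) h m y)); last first.
  by apply/funext => m; rewrite /h (RintegralZl _ mB (integrable_cell_green mB fi _ _)).
apply: fine_cvg; rewrite fineK; last exact: integrable_fin_num.
exact: c.
Qed.

End discrete_limit.

(** * Charge of a sublevel set of the Newtonian potential *)

Section level_charge.
Context {R : realType}.
Local Notation R3 := (R3 R).
Local Notation sigma := (sigma R).
Context (B : set R3) (mB : measurable B) (Boo : (sigma B < +oo)%E)
  (gB : quadratic_growth (B : set 'rV[R]_3)) (r : R)
  (Br : (B : set 'rV[R]_3) `<=` eball 0 r).
Context (f : R3 -> R) (fi : sigma.-integrable B (EFin \o f)).

(** Almost everywhere on [B], [w] is the indicator of the sublevel set and the potential differs
    from [l]; hence the indicators of the lattice sublevel sets are eventually equal to [w], and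
    [sublevel_charge_le0] passes to the limit. *)
Lemma sublevel_set_charge_le0 (w : R3 -> R) (l : R) : l < 0 -> measurable_fun B w ->
  (forall y, 0 <= w y <= 1) ->
  {ae sigma, forall x, B x ->
    let v := \int[sigma]_(y in B) (newton x y * f y) in
    w x = 1 /\ v < l \/ w x = 0 /\ l < v} ->
  \int[sigma]_(y in B) (w y * f y) <= 0.
Proof.
move=> l0 mw w01 wP; have [kappa k0 kP] := cell_potential_cvg mB gB fi.
pose c (m : nat) (y : R3) : bool :=
  (m%:R * cell_potential B f m%:R (cell m%:R y) <= kappa * l)%R.
pose h m (y : R3) : R := (c m y)%:R * f y.
have mc m : measurable_fun B (fun y => (c m y)%:R : R).
  apply: measurable_funTS; exact: (measurable_cell m%:R
    (fun z => ((m%:R * cell_potential B f m%:R z <= kappa * l)%R)%:R)).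
have hi m : sigma.-integrable B (EFin \o h m).
  apply: (integrable_bounded_mul mB (M := 1) (mc m) _ fi).
  by move=> y; case: (c m y); rewrite ?normr1 ?normr0.
have wi : sigma.-integrable B (EFin \o (fun y => w y * f y)).
  apply: (integrable_bounded_mul mB (M := 1) mw _ fi).
  by move=> y; have /andP[w0 w1] := w01 y; rewrite ger0_norm.
have hcvg : {ae sigma, forall y, B y ->
    (EFin \o h m) y @[m --> \oo] --> (EFin \o (fun y => w y * f y)) y}.
  have np := ae_integrable_newton mB Boo gB fi.
  apply: filterS2 wP np => x xP xi Bx.
  have := kP x (xi Bx); set v := \int[sigma]_(y in B) _ => vP.
  suff e : \forall m \near \oo, h m x = w x * f x.
    apply: cvg_EFin; first exact: nearW.
    apply: cvg_near_cst; exact: e.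
  case: (xP Bx) => [[-> vl]|[-> lv]].
  - have : \forall m \near \oo, m%:R * cell_potential B f m%:R (cell m%:R x) < kappa * l.
      by apply: (cvgr_lt _ vP); rewrite ltr_pM2l.
    by apply: filterS => m ml; rewrite /h /c ltW.
  - have : \forall m \near \oo, kappa * l < m%:R * cell_potential B f m%:R (cell m%:R x).
      by apply: (cvgr_gt _ vP); rewrite ltr_pM2l.
    by apply: filterS => m ml; rewrite /h /c leNgt ml.
have hdom : {ae sigma, forall y, forall m, B y -> (`|(EFin \o h m) y| <= (EFin \o (Num.norm \o f)) y)%E}.
  apply: aeW => y m By; rewrite /= lee_fin normrM ler_piMl//.
  by case: (c m y); rewrite ?normr1 ?normr0.
have [_ _ cv] := dominated_convergence mB (fun m => measurable_int _ (hi m)) (measurable_int _ wi)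
  hcvg (integrable_norm fi) hdom.
have cvR : \int[sigma]_(y in B) h m y @[m --> \oo] --> \int[sigma]_(y in B) (w y * f y).
  apply: fine_cvg; rewrite fineK; last exact: integrable_fin_num.
  exact: cv.
rewrite -(cvg_lim (@Rhausdorff R) cvR); apply: limr_le; first by apply/cvg_ex; eexists; exact: cvR.
(* The index 0 is skipped: [kappa * l / m] is a negative level only for [m > 0]. *)
exists 1%N => // m /= m1; have m0 : 0 < m%:R :> R by rewrite ltr0n.
have kl : kappa * l / m%:R < 0 by rewrite pmulr_llt0 ?invr_gt0// pmulr_rlt0.
apply: le_trans (sublevel_charge_le0 mB fi (ler0n R m) Br kl).
rewrite le_eqVlt; apply/orP; left; apply/eqP; apply: eq_Rintegral => y _.
by rewrite /h /c ler_pdivlMr// [m%:R * _]mulrC.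
Qed.

End level_charge.

(** * The capacitance matrix *)

Section capacitance.
Context {R : realType} {N : nat} {s : R} {D : 'I_N -> set 'rV[R]_3} {C : 'M[R]_N}.
Local Notation R3 := (R3 R).
Local Notation sigma := (sigma R).
Hypotheses (s0 : 0 < s) (hD : resonators s D) (hC : capacitance_matrix D C).
Let B : set R3 := boundary (\bigcup_n D n).
Let bd i : set R3 := boundary (D i).

Let mB : measurable B := measurable_boundary_resonators hD.
Let Boo : (sigma B < +oo)%E := sigma_boundary_lty s0 hD.
Let gB : quadratic_growth (B : set 'rV[R]_3) := quadratic_growth_boundary s0 hD.
Let mbd i : measurable (bd i) := measurable_boundary hD i.

Let bdB i : bd i `<=` B.
Proof. by rewrite /B (boundary_resonators hD) => x bx; exists i. Qed.

(** [|psi| <= 1 + psi^2], and [B] has finite area. *)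
Lemma square_integrable_integrable (psi : R3 -> R) :
  square_integrable B psi -> sigma.-integrable B (EFin \o psi).
Proof.
move=> [mpsi psi2].
have i2 : sigma.-integrable B (EFin \o (fun y => psi y ^+ 2)).
  apply/integrableP; split; first by apply/measurable_EFinP; exact: measurable_funX.
  by under eq_integral do rewrite /= ger0_norm ?sqr_ge0//.
have i1 : sigma.-integrable B (EFin \o cst 1).
  apply/integrableP; split; first by apply/measurable_EFinP; exact: measurable_cst.
  under eq_integral do rewrite /= normr1.
  by rewrite (integral_cst _ mB) mul1e.
apply: (le_integrable mB _ _ (integrableD mB i1 i2)).
  by apply/measurable_EFinP.
move=> y _; rewrite /= lee_fin [leRHS]ger0_norm ?addr_ge0 ?sqr_ge0//.
rewrite -[psi y ^+ 2]real_normK ?num_real//; have := sqr_ge0 (`|psi y| - 1); nra.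
Qed.

(** If some entry of [a] were negative, a sublevel set of the potential of [f] would be, up to a
    null set, the union of the boundaries with [a i < 0]. Its charge is the sum of the corresponding
    [(C a)_i], hence positive, against [sublevel_set_charge_le0]. *)
Lemma capacitance_monotone (a : 'cV[R]_N) :
  (forall i, 0 < (C *m a) i ord0) -> forall i, 0 <= a i ord0.
Proof.
move=> Ca k; rewrite leNgt; apply/negP => ak.
have [psi [/(_ _)/square_integrable_integrable psii psiS psiC]] := hC.
pose f (y : R3) := \sum_j (- a j ord0) * psi j y.
have fii i j : sigma.-integrable (bd i) (EFin \o (fun y => (- a j ord0) * psi j y)).
  exact: (integrableZl (mbd i) (- a j ord0)
    (integrableS mB (mbd i) (bdB (i := i)) (psii j))).
have fBi j : sigma.-integrable B (EFin \o (fun y => (- a j ord0) * psi j y)).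
  exact: (integrableZl mB (- a j ord0) (psii j)).
have [fi _] := Rintegral_sum mB (index_enum _) fBi.
have CaE i : (C *m a) i ord0 = \int[sigma]_(y in bd i) f y.
  have [_ ->] := Rintegral_sum (mbd i) (index_enum _) (fii i).
  rewrite mxE; apply: eq_bigr => j _.
  rewrite (RintegralZl _ (mbd i) (integrableS mB (mbd i) (bdB (i := i)) (psii j))) psiC.
  by rewrite mulrC mulrN mulNr.
(* Half the largest negative entry lies strictly above all negative entries and strictly below 0, so
   the potential avoids the level [4 * pi * l0]. The initial value [a k] of the maximum is itself a
   negative entry. *)
have [l0 l0n l0P] : exists2 l : R, l < 0 & forall i, a i ord0 < 0 -> a i ord0 < l.
  pose M := \big[Num.max/a k ord0]_(i | a i ord0 < 0) a i ord0.
  have M0 : M < 0 by apply: bigmax_lt.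
  exists (M / 2); first by rewrite pmulr_llt0.
  move=> i ai; have : a i ord0 <= M by exact: (le_bigmax_cond (a k ord0) (fun j => a j ord0) ai).
  lra.
pose w (y : R3) : R := \sum_(i | a i ord0 < 0) \1_(bd i) y.
have w_ind i j y : bd i y -> \1_(bd j) y = (i == j)%:R :> R.
  move=> biy; rewrite indicE; have [<-|ij] := eqVneq i j; first by rewrite mem_set.
  rewrite memNset// => bjy; have : (bd i `&` bd j) y by [].
  by rewrite /bd (boundary_resonators_disjoint hD ij).
have wE i y : bd i y -> w y = (a i ord0 < 0)%R%:R.
  move=> biy; rewrite /w; under eq_bigr do rewrite (w_ind i _ _ biy).
  have [ai|ai] := boolP (a i ord0 < 0).
    by rewrite (bigD1 i)//= eqxx big1 ?addr0// => j /andP[_ ji]; rewrite eq_sym (negbTE ji).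
  by rewrite big1// => j aj; case: eqP => // ij; rewrite ij aj in ai.
have w01 y : 0 <= w y <= 1.
  have [[i biy]|nb] := pselect (exists i, bd i y).
    by rewrite (wE i y biy); case: (_ < _); rewrite ?lexx ?ler01.
  rewrite /w big1 ?lexx ?ler01// => i _.
  by rewrite indicE memNset// => biy; apply: nb; exists i.
have mw : measurable_fun B w.
  have -> : w = (fun y => \sum_i (a i ord0 < 0)%R%:R * \1_(bd i) y).
    apply/funext => y; rewrite /w big_mkcond; apply: eq_bigr => i _.
    by case: ifP => _; rewrite ?mul1r ?mul0r.
  apply: measurable_sum => i; apply: measurable_funM; first exact: measurable_cst.
  exact: measurable_indic.
have [r _ Br] := boundary_sub_eball hD.
have l40 : 4 * pi * l0 < 0 by rewrite pmulr_rlt0// mulr_gt0// pi_gt0.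
have := sublevel_set_charge_le0 mB Boo gB Br fi l40 mw w01.
have ae : {ae sigma, forall x, B x ->
    let v := \int[sigma]_(y in B) (newton x y * f y) in
    w x = 1 /\ v < 4 * pi * l0 \/ w x = 0 /\ 4 * pi * l0 < v}.
  have np : {ae sigma, forall x, forall j, B x ->
      sigma.-integrable B (fun y => (newton x y * psi j y)%:E)}.
    apply: filter_forall => j; exact: (ae_integrable_newton mB Boo gB (psii j)).
  have sl : {ae sigma, forall x, forall j, B x -> single_layer B (psi j) x = \1_(bd j) x}.
    exact: filter_forall.
  apply: filterS2 np sl => x xi xs Bx v.
  have [i _ bix] : (\bigcup_n boundary (D n)) x by rewrite -(boundary_resonators hD).
  (* [single_layer] carries the factor [- 1 / (4 pi)], whence [- (4 pi)] here; the minus sign in [f]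
     cancels it. *)
  have vj j : \int[sigma]_(y in B) (newton x y * psi j y) = - (4 * pi) * (i == j)%:R.
    have := xs j Bx; rewrite (w_ind i j x bix) => <-; rewrite /single_layer.
    rewrite (_ : \int[sigma]_(y in B) ((4 * pi * enorm (x - y))^-1 * psi j y) =
        (4 * pi)^-1 * \int[sigma]_(y in B) (newton x y * psi j y)).
      by rewrite mulrNN mulVKf// gt_eqF// mulr_gt0// pi_gt0.
    rewrite -(RintegralZl _ mB (xi j Bx)); apply: eq_Rintegral => y _.
    by rewrite mulrA invfM.
  have -> : v = 4 * pi * a i ord0.
    have ii j : sigma.-integrable B
        (EFin \o (fun y => (- a j ord0) * (newton x y * psi j y))).
      exact: (integrableZl mB (- a j ord0) (xi j Bx)).
    have [_ e] := Rintegral_sum mB (index_enum _) ii.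
    transitivity (\int[sigma]_(y in B)
        (\sum_j (- a j ord0) * (newton x y * psi j y))).
      apply: eq_Rintegral => y _; rewrite /f mulr_sumr; apply: eq_bigr => j _.
      by rewrite mulrCA.
    rewrite e (bigD1 i)//= big1 ?addr0; last first.
      move=> j ji; rewrite (RintegralZl _ mB (xi j Bx)) vj eq_sym (negbTE ji).
      by rewrite !mulr0.
    by rewrite (RintegralZl _ mB (xi i Bx)) vj eqxx mulr1 mulrNN mulrC.
  rewrite (wE i x bix); case: (ltP (a i ord0) 0) => ai.
  - by left; split => //; rewrite ltr_pM2l ?mulr_gt0 ?pi_gt0// l0P.
  - by right; split => //; rewrite ltr_pM2l ?mulr_gt0 ?pi_gt0// (lt_le_trans l0n).
move=> /(_ ae); apply/negP; rewrite -ltNge.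
have -> : \int[sigma]_(y in B) (w y * f y) = \sum_(i | a i ord0 < 0) (C *m a) i ord0.
  pose g i (y : R3) : R := (a i ord0 < 0)%R%:R * (\1_(bd i) y * f y).
  have gi i : sigma.-integrable B (EFin \o g i).
    have i1 : sigma.-integrable B (fun y => (\1_(bd i) y * f y)%:E).
      apply: (integrable_bounded_mul mB (M := 1) _ _ fi).
        by apply: measurable_indic; exact: mbd.
      by move=> y; rewrite indicE; case: (y \in _); rewrite ?normr1 ?normr0.
    exact: (integrableZl mB _ i1).
  have [_ e] := Rintegral_sum mB (index_enum _) gi.
  transitivity (\int[sigma]_(y in B) (\sum_i g i y)).
    apply: eq_Rintegral => y _; rewrite /w mulr_suml big_mkcond; apply: eq_bigr => j _.
    by rewrite /g; case: ifP => _; rewrite ?mul1r ?mul0r.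
  rewrite e [RHS]big_mkcond; apply: eq_bigr => j _; rewrite /g; case: ifP => _.
    have -> : (C *m a) j ord0 = \int[sigma]_(y in B) (f \_ (bd j)) y.
      by rewrite CaE -Rintegral_mkcondr (setIidr (@bdB j)).
    apply: eq_Rintegral => y _; rewrite mul1r patchE indicE.
    by case: (y \in bd j); rewrite ?mul1r ?mul0r.
  by rewrite /Rintegral integral0_eq// => y _; rewrite mul0r.
(* The index [k] makes the sum nonempty, so it is strictly positive. *)
rewrite (bigD1 k)//= ltr_pwDl// sumr_ge0// => i _; exact: ltW.
Qed.

End capacitance.

Theorem theorem3p4 (R : realType) (N : nat) (s : R) (hs : 0 < s < 1)
    (D : 'I_N -> set 'rV[R]_3) (hD : resonators s D)
    (C : 'M[R]_N) (hC : capacitance_matrix D C)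
    (u : 'cV[R]_N) (hu : C *m u = const_mx 1)
    (lambda : R) (hlambda : 0 < lambda)
    (v : 'cV[R]_N) (hv : v != 0) (hev : C *m v = lambda *: v) (i : 'I_N) :
  `|v i ord0| / vnorm_max v <= lambda * u i ord0.
Proof.
have /andP[s0 _] := hs.
have vmax j : `|v j ord0| <= vnorm_max v by apply: le_bigmax.
have v0 : 0 < vnorm_max v.
  have [j vj] : exists j, v j ord0 != 0.
    apply/existsP; apply: contra_neqT hv => /existsPn vz.
    by apply/colP => j; rewrite mxE; apply/eqP; rewrite -[_ == _]negbK vz.
  by apply: lt_le_trans (vmax j); rewrite normr_gt0.
rewrite ler_pdivrMr//.
have u0 : 0 <= u i ord0.
  by apply: (capacitance_monotone s0 hD hC) => j; rewrite hu mxE.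
(* Applied with [t = 1] or [t = -1] according to the sign of [v i]. In [Ca] the [j]-th entry is
   [lambda |v| + d - t lambda v_j], which is at least [d]. *)
have key (t : R) : `|t| = 1 -> t * v i ord0 <= lambda * u i ord0 * vnorm_max v.
  move=> t1; apply/ler_addgt0Pr => e e0.
  (* This gives [d * u_i <= e]; adding 1 keeps the denominator positive when [u_i = 0]. *)
  pose d := e / (u i ord0 + 1).
  have u1 : 0 < u i ord0 + 1 by rewrite ltr_wpDl.
  have d0 : 0 < d by rewrite divr_gt0.
  have Ca j : 0 < (C *m ((lambda * vnorm_max v + d) *: u - t *: v)) j ord0.
    rewrite mulmxBr -!scalemxAr hu hev !mxE mulr1 subr_gt0.
    have : t * (lambda * v j ord0) <= lambda * vnorm_max v.
      rewrite mulrCA ler_pM2l//; apply: (le_trans (ler_norm _)).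
      by rewrite normrM t1 mul1r.
    move=> h; apply: (le_lt_trans h); by rewrite ltrDl.
  have := capacitance_monotone s0 hD hC Ca i.
  rewrite !mxE subr_ge0 mulrDl mulrAC => h; apply: (le_trans h); rewrite lerD2l.
  by rewrite /d mulrAC ler_pdivrMr// ler_wpM2l ?(ltW e0)// lerDl.
have [vi|vi] := ger0P (v i ord0).
- by have := key 1 (normr1 _); rewrite mul1r.
- by have := key (-1) (normrN1 _); rewrite mulN1r.
Qed.
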